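(* Let $(M,g,I,J,K)$ be an HKT manifold with $g$ definite (positive or negative), and suppose $M$ carries a nowhere zero special homothety generating a $D(2,1;\alpha)$-symmetry with $\alpha$ finite. (1) If $\alpha>0$, then for each $\alpha'>0$ the hypercomplex manifold $(M,I,J,K)$ also admits a definite HKT metric with a $D(2,1;\alpha')$-symmetry. (2) If $\alpha<0$ and $\alpha\neq-1$, then $(M,I,J,K)$ also admits a definite HKT metric with a $D(2,1;\alpha')$-symmetry for each $\alpha'<0$.
   Context: HKT manifold: a $4m$-manifold $M$ with integrable complex structures $I,J,K$ satisfying the quaternion identities ($I^2=J^2=K^2=-1$, $IJ=K=-JI$), a pseudo-Riemannian metric $g$ of signature $(4p,4q)$ Hermitian with respect to $I,J,K$, and a (unique) connection $\nabla$ with $\nabla g=0$, $\nabla I=\nabla J=\nabla K=0$ whose torsion $T(Y,Z)=\nabla_YZ-\nabla_ZY-[Y,Z]$ is totally skew, i.e. $c(W,Y,Z)=g(W,T(Y,Z))$ is a 3-form. Such a $g$ is called an HKT metric on the hypercomplex manifold $(M,I,J,K)$. Special homothety of type $(a,b)$, $a,b\in\mathbb R$ constants: a vector field $X$ with $L_Xg=ag$; $L_{IX}g=L_{JX}g=L_{KX}g=0$; $L_{IX}I=L_{JX}J=L_{KX}K=0$; and $L_{IX}J=bK$, $L_{JX}K=bI$, $L_{KX}I=bJ$. An HKT metric has a $D(2,1;\alpha)$-symmetry (generated by $X$), for finite $\alpha\in\mathbb R$, if $X$ is a special homothety of type $(a,b)$ for it with $b\neq0$ and $\alpha+1=a/b$.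 *)

(* Defs.v *)
From HB Require Import structures.
From mathcomp Require Import all_boot all_order all_algebra.
From mathcomp Require Import all_classical all_reals all_analysis.
From mathcomp Require Import ring.
Set Implicit Arguments.
Unset Strict Implicit.
Unset Printing Implicit Defensive.
Import Order.TTheory GRing.Theory Num.Theory.
Import numFieldNormedType.Exports.
Local Open Scope classical_set_scope.
Local Open Scope ring_scope.

Section SmoothOnOpenSets.
Variables (R : realType) (n : nat).
Implicit Types (k : nat) (U : set 'rV[R]_n) (f : 'rV[R]_n -> R).

(* C^k on U through iterated partial derivatives; only used on open U. *)
Fixpoint Ck k U f : Prop :=
  (forall x, U x -> {for x, continuous f}) /\
  if k is k'.+1 then
    forall i : 'I_n, (forall x, U x -> derivable f x (delta_mx 0 i)) /\
                     Ck k' U ('D_(delta_mx 0 i) f)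
  else True.

Definition smooth_on U f : Prop := forall k, Ck k U f.

Lemma near_eq_on U f f' x : open U -> (forall y, U y -> f y = f' y) -> U x ->
  \forall y \near x, f y = f' y.
Proof. by move=> oU ff' Ux; apply: filterS ff' _; exact: open_nbhs_nbhs. Qed.

Lemma continuous_eq_on U f f' x : open U -> (forall y, U y -> f y = f' y) ->
  U x -> {for x, continuous f} -> {for x, continuous f'}.
Proof.
move=> oU ff' Ux; rewrite /prop_for /continuous_at -(ff' _ Ux).
exact: cvg_trans (near_eq_cvg (near_eq_on oU ff' Ux)).
Qed.

Lemma Ck_eq k U f f' : open U -> (forall x, U x -> f x = f' x) ->
  Ck k U f -> Ck k U f'.
Proof.
move=> oU; elim: k f f' => [|k IH] f f' ff' /= [cf df].
  by split=> // x Ux; exact: continuous_eq_on oU ff' Ux (cf x Ux).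
split=> [x Ux|i]; first exact: continuous_eq_on oU ff' Ux (cf x Ux).
have [di Di] := df i; split=> [x Ux|].
  exact: near_eq_derivable (near_eq_on oU ff' Ux) (di x Ux).
by apply: IH Di => x Ux; exact: near_eq_derive (near_eq_on oU ff' Ux).
Qed.

Lemma CkS k U f : Ck k.+1 U f -> Ck k U f.
Proof.
elim: k f => [|k IH] f [cf df]; split=> // i.
by have [di Di] := df i; split=> //; apply: IH.
Qed.

Lemma Ck_cst k U (c : R) : Ck k U (cst c).
Proof.
elim: k c => [|k IH] c; first by split=> // x _; exact: cst_continuous.
split=> [x _|i]; first exact: cst_continuous.
split=> [x _|]; first exact: derivable_cst.
suff -> : 'D_(delta_mx 0 i) (cst c : 'rV[R]_n -> R) = cst 0 by [].
by apply/funext => x; rewrite derive_cst.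
Qed.

Lemma CkD k U f f' : open U -> Ck k U f -> Ck k U f' ->
  Ck k U (fun x => f x + f' x).
Proof.
move=> oU; elim: k f f' => [|k IH] f f' [cf df] [cf' df'].
  by split=> // x Ux; exact: cvgD (cf x Ux) (cf' x Ux).
split=> [x Ux|i]; first exact: cvgD (cf x Ux) (cf' x Ux).
have [di Di] := df i; have [di' Di'] := df' i; split=> [x Ux|].
  exact: derivableD (di x Ux) (di' x Ux).
apply: Ck_eq (IH _ _ Di Di') => // x Ux.
by rewrite (deriveD (di x Ux) (di' x Ux)).
Qed.

Lemma CkM k U f f' : open U -> Ck k U f -> Ck k U f' ->
  Ck k U (fun x => f x * f' x).
Proof.
move=> oU; elim: k f f' => [|k IH] f f' Cf Cf'.
  have [cf _] := Cf; have [cf' _] := Cf'.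
  by split=> // x Ux; exact: cvgM (cf x Ux) (cf' x Ux).
have [cf df] := Cf; have [cf' df'] := Cf'.
split=> [x Ux|i]; first exact: cvgM (cf x Ux) (cf' x Ux).
have [di Di] := df i; have [di' Di'] := df' i; split=> [x Ux|].
  exact: derivableM (di x Ux) (di' x Ux).
have := CkD oU (IH _ _ (CkS Cf) Di') (IH _ _ (CkS Cf') Di).
apply: Ck_eq => // x Ux.
by rewrite (deriveM (di x Ux) (di' x Ux)).
Qed.

End SmoothOnOpenSets.

(* A homeomorphism between an open subset of M and an open subset of R^n; the
   two maps are total but only meaningful on chart_dom and chart_img. *)
Record chart (R : realType) (n : nat) (M : topologicalType) := Chart {
  chart_dom : set M;
  chart_img : set 'rV[R]_n;
  chart_fwd : M -> 'rV[R]_n;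
  chart_bwd : 'rV[R]_n -> M;
  chart_dom_open : open chart_dom;
  chart_img_open : open chart_img;
  chart_fwd_img : forall p, chart_dom p -> chart_img (chart_fwd p);
  chart_bwd_dom : forall x, chart_img x -> chart_dom (chart_bwd x);
  chart_fwdK : forall p, chart_dom p -> chart_bwd (chart_fwd p) = p;
  chart_bwdK : forall x, chart_img x -> chart_fwd (chart_bwd x) = x;
  chart_fwd_cont : forall p, chart_dom p -> {for p, continuous chart_fwd};
  chart_bwd_cont : forall x, chart_img x -> {for x, continuous chart_bwd} }.

Record smoothManifold (R : realType) (n : nat) := SmoothManifold {
  carrier :> topologicalType;
  carrier_hausdorff : hausdorff_space carrier;
  carrier_second_countable : @second_countable carrier;
  atlas : set (chart R n carrier);
  atlas_cover : forall p : carrier, exists2 c, atlas c & chart_dom c p;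
  atlas_compatible : forall c d, atlas c -> atlas d -> forall i : 'I_n,
    smooth_on (chart_img c `&` chart_bwd c @^-1` chart_dom d)
              (fun x => chart_fwd d (chart_bwd c x) 0 i) }.

Section SmoothFunctions.
Variables (R : realType) (n : nat) (M : smoothManifold R n).

Definition smooth (f : M -> R) : Prop :=
  forall c, atlas c -> smooth_on (chart_img c) (f \o chart_bwd c).

Definition smooth_pred : {pred M -> R} := fun f => `[< smooth f >].

Fact smooth_subring : subring_closed smooth_pred.
Proof.
split=> [|f f' /asboolP sf /asboolP sf'|f f' /asboolP sf /asboolP sf'];
  apply/asboolP => c Ac k; have oc := @chart_img_open _ _ _ c.
- exact: Ck_cst.
- have := CkD oc (sf c Ac k) (CkM oc (Ck_cst k (chart_img c) (- 1)) (sf' c Ac k)).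
  by apply: Ck_eq => // x _; rewrite /= mulN1r.
- exact: CkM oc (sf c Ac k) (sf' c Ac k).
Qed.

Fact smooth_submod : submod_closed smooth_pred.
Proof.
split=> [|a f f' /asboolP sf /asboolP sf']; apply/asboolP => c Ac k;
  have oc := @chart_img_open _ _ _ c; first exact: Ck_cst.
exact: CkD oc (CkM oc (Ck_cst k (chart_img c) a) (sf c Ac k)) (sf' c Ac k).
Qed.

(* The ring of smooth functions, which is the zero ring when M is empty. *)
Record Cinf := MkCinf { cinf_fun :> M -> R; _ : cinf_fun \in smooth_pred }.

HB.instance Definition _ := [isSub for cinf_fun].
HB.instance Definition _ := [Choice of Cinf by <:].
HB.instance Definition _ := 
  GRing.SubChoice_isSubComPzRing.Build _ _ Cinf smooth_subring.
HB.instance Definition _ := 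
  GRing.SubZmodule_isSubLmodule.Build _ _ _ Cinf smooth_submod.

Lemma CinfP (f f' : Cinf) : (forall p, f p = f' p) -> f = f'.
Proof. by move=> ff'; apply/val_inj/funext. Qed.

Lemma CinfE (p : M) :
  (forall f h : Cinf, (f + h) p = f p + h p) *
  (forall f : Cinf, (- f) p = - f p) *
  (forall f h : Cinf, (f * h) p = f p * h p) *
  (forall (a : R) (f : Cinf), (a *: f) p = a * f p) *
  (forall (f : Cinf) (h : Cinf^o), (f *: h : Cinf) p = f p * (h : Cinf) p) *
  ((0 : Cinf) p = 0) * ((1 : Cinf) p = 1).
Proof. by []. Qed.

(* A smooth vector field is an R-linear derivation of the ring of smooth
   functions. *)
Definition derivation (D : Cinf -> Cinf^o) : Prop :=
  (forall (a : R) (f h : Cinf), D (a *: f + h) = a *: (D f : Cinf) + D h) /\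
  (forall f h : Cinf, D (f * h) = f * D h + h * D f).

Definition derivation_pred : {pred Cinf -> Cinf^o} := fun D => `[< derivation D >].

Fact derivation_submod : submod_closed derivation_pred.
Proof.
split=> [|u D E /asboolP [DL DM] /asboolP [EL EM]]; apply/asboolP; split.
- by move=> a f h; apply: CinfP => p; rewrite /= /cst /= scaler0 addr0.
- by move=> f h; apply: CinfP => p; rewrite /= !mulr0 addr0.
- move=> a f h; rewrite !fctE DL EL; apply: CinfP => p; rewrite !CinfE; ring.
- move=> f h; rewrite !fctE DM EM; apply: CinfP => p; rewrite !CinfE; ring.
Qed.

Record vectorField := MkVectorField {
  vf_fun :> Cinf -> Cinf^o; _ : vf_fun \in derivation_pred }.

HB.instance Definition _ := [isSub for vf_fun].
HB.instance Definition _ := [Choice of vectorField by <:].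
HB.instance Definition _ := 
  GRing.SubChoice_isSubLmodule.Build _ _ _ vectorField derivation_submod.

Fact bracket_subproof (X Y : vectorField) :
  (fun f => X (Y f) - Y (X f)) \in derivation_pred.
Proof.
case: X Y => [X /asboolP [XL XM]] [Y /asboolP [YL YM]] /=; apply/asboolP.
have XD f h : X (f + h) = X f + X h by have := XL 1 f h; rewrite !scale1r.
have YD f h : Y (f + h) = Y f + Y h by have := YL 1 f h; rewrite !scale1r.
split=> [a f h|f h]; apply: CinfP => p.
  by rewrite YL XL XL YL !CinfE; ring.
by rewrite !(YM, XM) XD YD !(XM, YM) !CinfE; ring.
Qed.

Definition bracket (X Y : vectorField) : vectorField :=
  MkVectorField (bracket_subproof X Y).

End SmoothFunctions.

Section Geometry.
Variables (R : realType) (n : nat) (M : smoothManifold R n).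
Local Notation VF := (vectorField M).
Local Notation C := (Cinf M).

(* T_pM is the space of derivations at p; vat Y p is the value of Y at p. *)
Definition tangent_vector (p : M) (v : C -> R) : Prop :=
  (forall (a : R) (f h : C), v (a *: f + h) = a * v f + v h) /\
  (forall f h : C, v (f * h) = f p * v h + h p * v f).

Definition vat (Y : VF) (p : M) : C -> R := fun f => (Y f : C) p.

Definition tangent_basis (k : nat) (p : M) (e : 'I_k -> VF) : Prop :=
  forall v, tangent_vector p v ->
    exists! c : 'I_k -> R, v = \sum_i c i *: vat (e i) p.

(* Tensor fields are C^oo(M)-multilinear maps on vector fields. *)
Definition bilinear_form (g : VF -> VF -> C) : Prop :=
  (forall Z, scalar (g^~ Z)) /\ (forall Y, scalar (g Y)).

Definition three_form (c : VF -> VF -> VF -> C) : Prop :=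
  [/\ forall Y Z, scalar (fun W => c W Y Z),
      forall W Z, scalar (fun Y => c W Y Z),
      forall W Y, scalar (fun Z => c W Y Z) &
      forall W Y, [/\ c W W Y = 0, c W Y Y = 0 & c W Y W = 0]].

(* The values at each point of suitable vector fields form an orthonormal basis
   with r vectors of square 1 and s vectors of square -1. *)
Definition has_signature (r s : nat) (g : VF -> VF -> C) : Prop :=
  forall p : M, exists e : 'I_(r + s) -> VF,
    tangent_basis p e /\
    forall i j, g (e i) (e j) p =
      if i == j then (if (i < r)%N then 1 else -1) else 0.

Definition pseudo_riemannian (r s : nat) (g : VF -> VF -> C) : Prop :=
  [/\ bilinear_form g, forall Y Z, g Y Z = g Z Y & has_signature r s g].

Definition positive_definite (g : VF -> VF -> C) : Prop :=
  forall (p : M) Y, vat Y p <> 0 -> 0 < g Y Y p.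

Definition negative_definite (g : VF -> VF -> C) : Prop :=
  forall (p : M) Y, vat Y p <> 0 -> g Y Y p < 0.

Definition definite (g : VF -> VF -> C) : Prop :=
  positive_definite g \/ negative_definite g.

Definition nowhere_zero (X : VF) : Prop := forall p : M, vat X p <> 0.

(* Integrability of an almost complex structure is taken in the Nijenhuis form;
   the last term uses I^2 = -1. *)
Definition nijenhuis (I : VF -> VF) (Y Z : VF) : VF :=
  bracket (I Y) (I Z) - I (bracket (I Y) Z) - I (bracket Y (I Z)) - bracket Y Z.

Definition integrable (I : VF -> VF) : Prop := forall Y Z, nijenhuis I Y Z = 0.

Definition hypercomplex (I J K : {linear VF -> VF}) : Prop :=
  [/\ integrable I, integrable J & integrable K] /\
  forall Y, [/\ I (I Y) = - Y, J (J Y) = - Y, K (K Y) = - Y,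
                I (J Y) = K Y & J (I Y) = - K Y].

Definition hermitian (I : VF -> VF) (g : VF -> VF -> C) : Prop :=
  forall Y Z, g (I Y) (I Z) = g Y Z.

(* nabla Y Z stands for the covariant derivative of Z along Y. *)
Definition connection (nabla : VF -> VF -> VF) : Prop :=
  [/\ forall Z, linear (nabla^~ Z),
      forall Y, {morph nabla Y : Z W / Z + W} &
      forall Y (f : C) Z, nabla Y (f *: Z) = (Y f : C) *: Z + f *: nabla Y Z].

Definition torsion (nabla : VF -> VF -> VF) (Y Z : VF) : VF :=
  nabla Y Z - nabla Z Y - bracket Y Z.

Definition parallel_metric (nabla : VF -> VF -> VF) (g : VF -> VF -> C) : Prop :=
  forall Y Z W : VF, Y (g Z W) = g (nabla Y Z) W + g Z (nabla Y W).

Definition parallel_endo (nabla : VF -> VF -> VF) (I : VF -> VF) : Prop :=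
  forall Y Z, nabla Y (I Z) = I (nabla Y Z).

Definition HKT_metric (I J K : {linear VF -> VF}) (g : VF -> VF -> C) : Prop :=
  [/\ exists p q : nat, n = (4 * p + 4 * q)%N /\ pseudo_riemannian (4 * p) (4 * q) g,
      hermitian I g, hermitian J g, hermitian K g &
      exists nabla : VF -> VF -> VF,
        [/\ connection nabla, parallel_metric nabla g,
            [/\ parallel_endo nabla I, parallel_endo nabla J & parallel_endo nabla K] &
            three_form (fun W Y Z => g W (torsion nabla Y Z))]].

Definition lie_metric (X : VF) (g : VF -> VF -> C) (Y Z : VF) : C :=
  (X (g Y Z) : C) - g (bracket X Y) Z - g Y (bracket X Z).

Definition lie_endo (X : VF) (I : VF -> VF) (Y : VF) : VF :=
  bracket X (I Y) - I (bracket X Y).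

(* Vector fields form a module over C^oo(M) only, so the real number b acts
   through the constant function b *: 1. *)
Definition special_homothety (a b : R) (I J K : {linear VF -> VF})
    (g : VF -> VF -> C) (X : VF) : Prop :=
  [/\ forall Y Z, lie_metric X g Y Z = a *: g Y Z,
      forall Y Z, [/\ lie_metric (I X) g Y Z = 0, lie_metric (J X) g Y Z = 0 &
                      lie_metric (K X) g Y Z = 0],
      forall Y, [/\ lie_endo (I X) I Y = 0, lie_endo (J X) J Y = 0 &
                    lie_endo (K X) K Y = 0] &
      forall Y, [/\ lie_endo (I X) J Y = (b *: (1 : C)) *: K Y,
                    lie_endo (J X) K Y = (b *: (1 : C)) *: I Y &
                    lie_endo (K X) I Y = (b *: (1 : C)) *: J Y]].

Definition generates_D21 (alpha : R) (I J K : {linear VF -> VF})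
    (g : VF -> VF -> C) (X : VF) : Prop :=
  exists a b : R, [/\ special_homothety a b I J K g X, b <> 0 & alpha + 1 = a / b].

Definition has_D21_symmetry (alpha : R) (I J K : {linear VF -> VF})
    (g : VF -> VF -> C) : Prop :=
  exists X : VF, generates_D21 alpha I J K g X.

End Geometry.

(* Main.v *)
Require Import Defs.
From HB Require Import structures.
From mathcomp Require Import all_boot all_order all_algebra.
From mathcomp Require Import all_classical all_reals all_analysis.
From mathcomp Require Import ring lra.
Set Implicit Arguments.
Unset Strict Implicit.
Unset Printing Implicit Defensive.
Import Order.TTheory GRing.Theory Num.Theory.
Import numFieldNormedType.Exports.
Local Open Scope classical_set_scope.
Local Open Scope ring_scope.

(** Let [nu = g(X, X)], and let [P] be the [g]-orthogonal projection onto the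
    span of [X], [IX], [JX], [KX]. The new metric is
      [g' = f (g + t g(P _, _))],  [f = |nu|^(k - 1)],
    with constants [k] and [t]. When [k <> 0] this is, up to a constant factor,
    the metric whose HKT potential is the [k]-th power of the potential of [g],
    the latter being a constant multiple of [nu]; [k = 0] corresponds to the
    logarithm of the potential.

    Since [X nu = a nu], the field [X] scales [g'] by [k a], while the conditions
    on [I], [J], [K] do not involve the metric; so [X] is a special homothety of
    type [(k a, b)] for [g'], and a [D(2,1;alpha')]-symmetry is obtained for
    [k = (alpha' + 1) / (alpha + 1)]. The HKT condition on [g'] turns out to be
    [t (a - b) = (k - 1) a], that is [1 + t = alpha' / alpha]. As [g'] is [f g] on
    the orthogonal complement of the image of [P] and [f (1 + t) g] on this image,
    it is definite with the same sign as [g] when [alpha' / alpha > 0]. This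
    inequality holds in both cases of the theorem, so both are instances of
    [D21_deformation].

    The connection of [g'] is given by a formula, [deform_nabla], rather than
    derived from the existence theory of HKT structures. It rests on three facts
    about the connection [nabla] of [g] and its torsion [T]: [nabla X] is [a/2]
    times the identity ([nabla_homothety]); [T(X, _)] vanishes
    ([torsion_homothety]); and for [A] among [I], [J], [K] the endomorphism
    [T(AX, _) + (a + b)/2 A] commutes with [I], [J] and [K]
    ([centralizing_torsionP]). With these the verification is algebra over the
    ring of smooth functions ([correction_metric], [correction_torsion]).

    Vector fields are derivations of the ring of smooth functions and tensors are
    multilinear over this ring, so two basic facts have to be proved without
    coordinates: derivations obey the chain rule for real powers ([vf_exp],
    [real_power]), and the value of a tensor at a point depends only on the values
    of its arguments there ([tensorial]). *)

(** * The quotient of [exp x - 1] by [x], and composition with smooth functions *)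

Section Expm.
Variable R : realType.
Implicit Types (x : R) (k n : nat).

(** [expm k] is the [k]-th derivative of the entire function that extends
    [(exp x - 1) / x], given by its power series. *)
Definition expm_coeff k n : R := (n`!%:R * (n + k).+1%:R)^-1.

Definition expm k x : R := limn (pseries (expm_coeff k) x).

Lemma expm_coeff_diffs k : pseries_diffs (expm_coeff k) = expm_coeff k.+1.
Proof.
apply/funext => n; rewrite /pseries_diffs /expm_coeff factS natrM addSnnS.
by rewrite -mulrA invfM mulVKf // pnatr_eq0.
Qed.

Lemma is_cvg_expm k x : cvgn (pseries (expm_coeff k) x).
Proof.
apply: normed_cvg; apply: series_le_cvg (is_cvg_series_exp_coeff `|x|) => [n|n|n].
- exact: normr_ge0.
- exact: exp_coeff_ge0.
rewrite /exp_coeff /= normrM normrX mulrC ler_wpM2l ?exprn_ge0 //.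
rewrite /expm_coeff ger0_norm ?invr_ge0 ?mulr_ge0 // invfM ler_piMr ?invr_ge0 //.
by rewrite invf_le1 // ler1n.
Qed.

Lemma is_derive_expm k x : is_derive x 1 (expm k) (expm k.+1 x).
Proof.
rewrite /expm -(expm_coeff_diffs k).
apply: (@pseries_snd_diffs _ _ (`|x| + 1)).
- exact: is_cvg_expm.
- by rewrite expm_coeff_diffs; exact: is_cvg_expm.
- by rewrite !expm_coeff_diffs; exact: is_cvg_expm.
- by rewrite [ltRHS]ger0_norm ?addr_ge0 // ltrDl.
Qed.

Lemma expm0E x : expR x = 1 + x * expm 0 x.
Proof.
have cE : 1 + x * pseries (expm_coeff 0) x n @[n --> \oo] --> 1 + x * expm 0 x.
  by apply: cvgD; [exact: cvg_cst|apply: cvgMr; exact: is_cvg_expm].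
rewrite -(cvg_lim _ cE) //; apply/esym/cvg_lim => //.
have := is_cvg_series_exp_coeff x; rewrite -(cvg_shiftS (series (exp_coeff x))).
suff -> : (fun n => 1 + x * pseries (expm_coeff 0) x n)
        = (fun n => series (exp_coeff x) n.+1) by [].
apply/funext => n; rewrite /pseries /series /= big_nat_recl //=.
rewrite /exp_coeff /= expr0 fact0 divr1 mulr_sumr; congr (_ + _).
apply: eq_bigr => i _; rewrite /expm_coeff addn0 exprS factS natrM mulrCA.
by rewrite mulrC [_`!%:R * _]mulrC.
Qed.

Lemma expm00 : expm 0 (0 : R) = 1.
Proof.
have [_ dE] : is_derive (0 : R) (1 : R) (cst 1 + id * expm 0) (expm 0 0).
  have dm := is_derive_expm 0 (0 : R).
  apply: is_derive_eq (is_deriveD (is_derive_cst _ _ _) (is_deriveM _ dm)) _.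
  by rewrite add0r scale0r add0r [_ *: _]mulr1.
rewrite -dE (_ : cst 1 + id * expm 0 = expR); last exact/esym/funext/expm0E.
by have [_ ->] := is_derive_expR (0 : R); rewrite expR0.
Qed.

End Expm.

Section ChainRule.
Variables (R : realType) (n : nat).

Lemma is_derive_comp_real (F : R -> R) (u : 'rV[R]_n -> R) x v (dF du : R) :
  is_derive (u x) 1 F dF -> is_derive x v u du ->
  is_derive x v (F \o u) (dF * du).
Proof.
move=> [Fd FE] [ud uE].
have line0 : u (0 *: v + x) = u x by rewrite scale0r add0r.
have ud1 := (derivable1P u x v).1 ud.
have uE1 : 'D_1 (fun h : R => u (h *: v + x)) 0 = du.
  rewrite -uE /derive; apply: (congr1 (fun F : R -> R => lim (F @ 0^'))).
  apply/funext => h.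
  by rewrite /= addr0 line0 [h%:A]mulr1.
have Fd1 : derivable F (u (0 *: v + x)) 1.
  exact: (eq_ind_r (fun y => derivable F y 1) Fd line0).
apply: DeriveDef.
  apply/derivable1P/derivable1_diffP.
  by apply: (@differentiable_comp _ _ _ _ (fun h : R => u (h *: v + x)));
    exact/derivable1_diffP.
have := derive1_comp ud1 Fd1; rewrite line0 !derive1E FE uE1 mulrC => <-.
rewrite /derive; apply: (congr1 (fun F : R -> R => lim (F @ 0^'))).
apply/funext => h.
by rewrite /= addr0 line0 [h%:A]mulr1.
Qed.

(** Iterated derivatives are carried along as a whole sequence, which turns
    the smoothness of a composite into an induction on the order. *)
Lemma Ck_comp (F : nat -> R -> R) (U : set 'rV[R]_n) (u : 'rV[R]_n -> R)
    (k j : nat) :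
  open U -> (forall i (x : R), is_derive x (1 : R) (F i) (F i.+1 x)) ->
  Ck k U u -> Ck k U (F j \o u).
Proof.
move=> oU dF; have cF i : continuous (F i).
  by move=> x; apply/differentiable_continuous/derivable1_diffP; case: (dF i x).
elim: k j => [|k IH] j Cu.
  have [cu _] := Cu; split=> // x Ux; apply: continuous_comp; first exact: cu.
  exact: cF.
have [cu du] := Cu; split=> [x Ux|i].
  by apply: continuous_comp; [exact: cu|exact: cF].
have [di Di] := du i.
have dFu x : U x -> is_derive x (delta_mx 0 i) (F j \o u)
    (F j.+1 (u x) * 'D_(delta_mx 0 i) u x).
  by move=> Ux; apply: is_derive_comp_real (dF j (u x)) _; apply/derivableP/di.
split=> [x Ux|]; first by case: (dFu x Ux).
apply: (Ck_eq oU) (CkM oU (IH j.+1 (CkS Cu)) Di) => x Ux.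
by have [_ ->] := dFu x Ux.
Qed.

End ChainRule.

(** * Vector fields as derivations: exponentials, logarithms, powers *)

Section Derivations.
Variables (R : realType) (n : nat) (M : smoothManifold R n).
Local Notation C := (Cinf M).
Local Notation VF := (vectorField M).
Implicit Types (f h : C) (Y Z : VF) (p : M).

Lemma Cinf_smooth f : smooth f.
Proof. by case: f => f /= /asboolP. Qed.

Lemma vf_derivation Y : derivation Y.
Proof. by case: Y => Y /= /asboolP. Qed.

Lemma vfL Y (a : R) f h : Y (a *: f + h) = a *: (Y f : C) + Y h.
Proof. by case: (vf_derivation Y). Qed.

Lemma vfM Y f h : Y (f * h) = f * (Y h : C) + h * (Y f : C).
Proof. by case: (vf_derivation Y). Qed.

Lemma vf_add Y f h : Y (f + h) = (Y f : C) + Y h.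
Proof. by have := vfL Y 1 f h; rewrite !scale1r. Qed.

Lemma vf0 Y : Y 0 = 0.
Proof. by apply: (addrI (Y 0 : C)); rewrite -vf_add !addr0. Qed.

Lemma vf_scale Y (a : R) f : Y (a *: f) = a *: (Y f : C).
Proof. by have := vfL Y a f 0; rewrite vf0 !addr0. Qed.

Lemma vf1 Y : Y 1 = 0.
Proof.
by apply: (addrI (Y 1 : C)); rewrite addr0 -{3}[1 : C]mulr1 vfM !mul1r.
Qed.

Lemma vatP Y Z : (forall f p, vat Y p f = vat Z p f) -> Y = Z.
Proof. by move=> YZ; apply/val_inj/funext => f; apply: CinfP => p; exact: YZ. Qed.

Lemma vatE p f :
  (forall Y Z, vat (Y + Z) p f = vat Y p f + vat Z p f) *
  (forall Y, vat (- Y) p f = - vat Y p f) *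
  (forall h Y, vat (h *: Y) p f = h p * vat Y p f) *
  (vat (0 : VF) p f = 0).
Proof. by []. Qed.

Lemma bracketE Y Z f : bracket Y Z f = Y (Z f) - (Z (Y f) : C).
Proof. by []. Qed.

Lemma bracket_anti Y Z : bracket Z Y = - bracket Y Z.
Proof. by apply: vatP => h x; rewrite !vatE /vat !bracketE !CinfE; ring. Qed.

Lemma bracket_self Y : bracket Y Y = 0.
Proof. by apply: vatP => h x; rewrite /vat bracketE subrr. Qed.

Lemma smooth_comp (F : nat -> R -> R) f j :
  (forall i (x : R), is_derive x (1 : R) (F i) (F i.+1 x)) ->
  F j \o f \in @smooth_pred R n M.
Proof.
move=> dF; apply/asboolP => c Ac k.
apply: (@Ck_comp _ _ _ _ (f \o chart_bwd c)) dF _; first exact: chart_img_open.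
exact: Cinf_smooth.
Qed.

Definition expC f : C :=
  MkCinf (@smooth_comp (fun=> expR) f 0%N (fun=> @is_derive_expR R)).

Definition expmC f : C :=
  MkCinf (@smooth_comp (@expm R) f 0%N (@is_derive_expm R)).

Lemma expCE f p : expC f p = expR (f p). Proof. by []. Qed.

(** An abstract derivation is not known to act through the partial
    derivatives in a chart, so the chain rule is deduced from the Leibniz rule:
    if [h] vanishes at [p], then [exp h - 1] is [h] times a smooth function with
    value 1 at [p]. *)
Lemma vf_exp Y f : Y (expC f) = expC f * (Y f : C).
Proof.
apply: CinfP => p.
pose h := f + (- f p) *: (1 : C).
have -> : expC f = expR (f p) *: (1 + h * expmC h).
  apply: CinfP => q; rewrite !CinfE expCE -/(expm 0 (h q)) -expm0E -expRD.
  by rewrite mulr1 addrC subrK.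
have hp : h p = 0 by rewrite !CinfE mulr1 subrr.
have Yh : Y h = Y f by rewrite vf_add vf_scale vf1 scaler0 addr0.
clearbody h; rewrite vf_scale vf_add vf1 vfM Yh !CinfE hp.
rewrite -[expmC h p]/(expm 0 (h p)) hp.
by rewrite expm00; ring.
Qed.

(** The derivative of [ln u] is [exp (- ln u)] times that of [u], and both factors
    are as smooth as the induction hypothesis provides. *)
Lemma Ck_ln k (U : set 'rV[R]_n) (u : 'rV[R]_n -> R) :
  open U -> (forall x, U x -> 0 < u x) -> Ck k U u -> Ck k U (@ln R \o u).
Proof.
move=> oU u0; elim: k => [|k IH] Cu.
  have [cu _] := Cu; split=> // x Ux; apply: continuous_comp; first exact: cu.
  exact/continuous_ln/u0.
have [cu du] := Cu; split=> [x Ux|i].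
  by apply: continuous_comp; [exact: cu|exact/continuous_ln/u0].
have [di Di] := du i.
have dlnu x : U x -> is_derive x (delta_mx 0 i) (@ln R \o u)
    ((u x)^-1 * 'D_(delta_mx 0 i) u x).
  move=> Ux; apply: is_derive_comp_real; first exact/is_derive1_ln/u0.
  exact/derivableP/di.
split=> [x Ux|]; first by case: (dlnu x Ux).
have CV : Ck k U (fun x => expR (-1 * ln (u x))).
  apply: (@Ck_comp _ _ (fun=> expR) _ (fun x => -1 * ln (u x)) k 0 oU) => //.
  by apply: CkM => //; [exact: Ck_cst|exact: IH (CkS Cu)].
apply: (Ck_eq oU) (CkM oU CV Di) => x Ux; have [_ ->] := dlnu x Ux.
by rewrite mulN1r expRN lnK // posrE u0.
Qed.

Lemma smooth_ln f : (forall p, 0 < f p) -> @ln R \o f \in @smooth_pred R n M.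
Proof.
move=> f0; apply/asboolP => c Ac k.
apply: (@Ck_ln _ _ (f \o chart_bwd c)) => [|x _|]; first exact: chart_img_open.
  exact: f0.
exact: Cinf_smooth.
Qed.

Lemma expC_surj f : (forall p, 0 < f p) -> exists h, f = expC h.
Proof.
move=> f0; exists (MkCinf (smooth_ln f0)); apply: CinfP => p.
by rewrite expCE /= lnK // posrE.
Qed.

(** Real powers of a nowhere zero smooth function, through the logarithm of its
    square. *)
Lemma real_power (nu : C) (k : R) : (forall x, nu x != 0) ->
  exists f iv : C, [/\ forall x, iv x = (nu x)^-1, forall x, 0 < f x,
    forall Y, Y iv = - (iv * iv * (Y nu : C)) &
    forall Y, Y f = k *: (f * iv * (Y nu : C))].
Proof.
move=> nu0; have nu2 x : 0 < (nu * nu) x.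
  by rewrite !CinfE -expr2 lt_neqAle sqr_ge0 eq_sym sqrf_eq0 nu0.
have [L LE] := expC_surj nu2.
pose iv := nu * expC (- L).
have ivE x : iv x = (nu x)^-1.
  have Lx : nu x * nu x = expR (L x) := congr1 (fun h : C => h x) LE.
  have -> : iv x = nu x * expR (- L x) by [].
  by rewrite expRN -Lx invfM mulVKf.
clearbody iv; have ivnu : iv * nu = 1.
  by apply: CinfP => x; rewrite !CinfE ivE mulVf.
have div Y : Y iv = - (iv * iv * (Y nu : C)).
  have e : iv * (Y nu : C) + nu * (Y iv : C) = 0 by rewrite -vfM ivnu vf1.
  transitivity (iv * nu * (Y iv : C)); first by rewrite ivnu mul1r.
  move/eqP: e; rewrite addrC addr_eq0 => /eqP e.
  by rewrite -mulrA e; ring.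
have dL Y : Y L = (iv * (Y nu : C)) *+ 2 :> C.
  have := vf_exp Y L; rewrite -LE vfM => e.
  transitivity (iv * iv * (nu * nu * (Y L : C))).
    by rewrite mulrA mulrACA ivnu !mul1r.
  rewrite -e; transitivity (iv * nu * (iv * (Y nu : C)) *+ 2); first by ring.
  by rewrite ivnu mul1r.
exists (expC ((k / 2) *: L)), iv; split=> // [x|Y]; first by rewrite expCE expR_gt0.
rewrite vf_exp vf_scale dL.
by apply: CinfP => x; rewrite mulr2n !CinfE; field.
Qed.

End Derivations.

(** * The value of a tensor at a point *)

Section Tensoriality.
Variables (R : realType) (n : nat) (M : smoothManifold R n).
Local Notation C := (Cinf M).
Local Notation VF := (vectorField M).
Implicit Types (f h : C) (Y Z : VF) (p q : M).

Definition evalC p : C -> R := fun f => f p.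

Fact evalC_additive p : zmod_morphism (evalC p). Proof. by []. Qed.
Fact evalC_monoid p : monoid_morphism (evalC p). Proof. by []. Qed.
HB.instance Definition _ p :=
  GRing.isZmodMorphism.Build C R (evalC p) (@evalC_additive p).
HB.instance Definition _ p :=
  GRing.isMonoidMorphism.Build C R (evalC p) (@evalC_monoid p).

Lemma vat_tangent Y p : tangent_vector p (vat Y p).
Proof.
by split=> [a f h|f h]; rewrite /vat ?vfL ?vfM.
Qed.

(** Linearly independent functionals are separated by evaluations: a family of
    evaluation points whose matrix has maximal rank must have full rank. *)
Lemma independent_functionals (T : Type) k (v : 'I_k -> T -> R) :
  (forall c : 'I_k -> R, (forall t, \sum_i c i * v i t = 0) ->
     forall i, c i = 0) ->
  exists t : 'I_k -> T, (\matrix_(i, j) v i (t j)) \in unitmx.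
Proof.
move=> ind.
suff [t tU] : exists t : 'I_k -> T, row_free (\matrix_(j, i) v i (t j)).
  exists t; rewrite -unitmx_tr -row_free_unit; congr row_free: tU.
  by apply/matrixP => i j; rewrite !mxE.
suff /(_ k (leqnn k)) : forall r, (r <= k)%N ->
  exists t : 'I_r -> T, row_free (\matrix_(j < r, i < k) v i (t j)) by [].
(* As long as fewer than [k] evaluation points are used, some combination [c] of
   the functionals vanishes at all of them; a point where it does not vanish
   increases the rank. *)
elim=> [_|r IH rk].
  have t0 : 'I_0 -> T by case.
  by exists t0; rewrite /row_free flatmx0 mxrank0.
have [t tF] := IH (ltnW rk).
set A := (X in row_free X) in tF.
have [c [c0 Ac]] : exists c : 'rV[R]_k, c != 0 /\ c *m A^T = 0.
  have : kermx A^T != 0.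
    by rewrite kermx_eq0 /row_free mxrank_tr (eqP tF) neq_ltn rk.
  by case/rowV0Pn => c /sub_kermxP ? ?; exists c.
have [s sc] : exists s, \sum_i c 0 i * v i s != 0.
  apply: contrapT => /forallNP ns; case/negP: c0; apply/eqP/rowP => i.
  rewrite mxE; apply: (ind (c 0)) => s.
  by apply/eqP; case: eqP (ns s) => // _ [].
pose u : 'rV[R]_k := \row_i v i s.
have uA : ~~ submx u A.
  apply: contra sc => /submxP [d ud].
  have : u *m c^T = 0 by rewrite ud -mulmxA -[A]trmxK -trmx_mul Ac trmx0 mulmx0.
  move/(congr1 (fun B : 'M[R]_1 => B 0 0)); rewrite !mxE => uc.
  by apply/eqP; rewrite -[RHS]uc; apply: eq_bigr => i _; rewrite !mxE mulrC.
exists (fun i : 'I_(1 + r) => match fintype.split i with inl _ => s | inr j => t j end).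
set B := (X in row_free X).
have -> : B = col_mx u A.
  by apply/matrixP => i j; rewrite !mxE; case: fintype.split => ?; rewrite mxE.
rewrite /row_free eqn_leq rank_leq_row /= -[X in (X < _)%N](eqP tF).
have uAE := eqmx_sym (addsmxE u A).
apply: rank_ltmx; rewrite /ltmx !uAE addsmxSr /=.
by apply: contra uA; apply: submx_trans; exact: addsmxSl.
Qed.

Definition independent_at k p (e : 'I_k -> VF) :=
  forall c : 'I_k -> R, \sum_i c i *: vat (e i) p = 0 -> forall i, c i = 0.

Lemma tangent_basis_independent k p (e : 'I_k -> VF) :
  tangent_basis p e -> independent_at p e.
Proof.
move=> be c c0 i.
have t0 : tangent_vector p (0 : C -> R).
  split=> [a f h|f h].
    by rewrite -[LHS]/(0 : R) -[RHS]/(a * 0 + 0 : R) mulr0 addr0.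
  by rewrite -[LHS]/(0 : R) -[RHS]/(f p * 0 + h p * 0) !mulr0 addr0.
have [d [_ uniq]] := be _ t0.
rewrite -(uniq c (esym c0)) (uniq (fun=> 0)) //.
by rewrite big1 // => j _; rewrite scale0r.
Qed.

(** The dimension count: [k] independent vectors in a [k]-dimensional space. *)
Lemma independent_tangent_basis k p (e e' : 'I_k -> VF) :
  tangent_basis p e -> independent_at p e' -> tangent_basis p e'.
Proof.
move=> be ie'.
have /choice[m me] i : exists c : 'I_k -> R,
    vat (e' i) p = \sum_j c j *: vat (e j) p.
  by have [c [cE _]] := be _ (vat_tangent (e' i) p); exists c.
pose A := \matrix_(i, j) m i j.
have sumA (c : 'rV_k) :
    \sum_i c 0 i *: vat (e' i) p = \sum_j (c *m A) 0 j *: vat (e j) p.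
  under eq_bigr do rewrite me scaler_sumr.
  rewrite exchange_big /=; apply: eq_bigr => j _.
  rewrite mxE scaler_suml; apply: eq_bigr => i _.
  by rewrite mxE scalerA.
have Au : A \in unitmx.
  rewrite -row_free_unit; apply: inj_row_free => c cA; apply/rowP => i.
  rewrite mxE; apply: (ie' (fun j => c 0 j)).
  by rewrite sumA cA big1 // => j _; rewrite mxE scale0r.
move=> v tv; have [d [dE _]] := be v tv.
pose c := (\row_i d i) *m invmx A.
have cE : v = \sum_i c 0 i *: vat (e' i) p.
  by rewrite sumA mulmxKV // dE; apply: eq_bigr => j _; rewrite mxE.
exists (fun i => c 0 i); split=> // c' c'E; apply/funext => i.
apply/eqP; rewrite -subr_eq0; apply/eqP.
apply: (ie' (fun j => c 0 j - c' j)).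
by under eq_bigr do rewrite scalerBl; rewrite sumrB -cE -c'E subrr.
Qed.

Lemma scalar_sum (phi : VF -> C) k (f : 'I_k -> C) (e : 'I_k -> VF) :
  scalar phi -> phi (\sum_i f i *: e i) = \sum_i f i * phi (e i).
Proof.
move=> lphi; pose scM := GRing.isLinear.Build _ _ _ _ _ lphi.
pose psi : {scalar VF} := HB.pack phi scM.
by rewrite -[phi]/(psi : _ -> _) linear_sum; apply: eq_bigr => i _; rewrite linearZ.
Qed.

(** Near [p] a field is a combination of a frame, the coefficients being given
    by Cramer's rule from the action on functions [h]; multiplication by the
    determinant [D] turns this into a global identity without a cut-off function. *)
Lemma tensorial k (phi : VF -> C) Y p :
  (forall q, exists e : 'I_k -> VF, tangent_basis q e) -> scalar phi ->
  vat Y p = 0 -> phi Y p = 0.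
Proof.
move=> frames lphi Y0; have [e be] := frames p.
have [c c0|h hU] := @independent_functionals C k (fun i f => (e i f : C) p).
  apply: (tangent_basis_independent be).
  by apply/funext => f; rewrite fct_sumE -[RHS](c0 f).
pose A : 'M[C]_k := \matrix_(i, j) e i (h j).
have Aq q : map_mx (evalC q) A = \matrix_(i, j) (e i (h j) : C) q.
  by apply/matrixP => i j; rewrite !mxE.
pose D := \det A.
have Dq q : D q = \det (map_mx (evalC q) A) by rewrite det_map_mx.
have Dp : D p != 0 by rewrite Dq Aq -unitfE -unitmxE.
pose F i := \sum_j (Y (h j) : C) * \adj A j i.
pose Z := D *: Y - \sum_i F i *: e i.
have sumE q (G : 'I_k -> C) f :
    vat (\sum_i G i *: e i) q f = \sum_i G i q * vat (e i) q f.
  elim/big_ind2: _ => [//|V x W y Vx Wy|//].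
  by rewrite vatE Vx Wy.
have Zh l q : vat Z q (h l) = 0.
  rewrite !vatE sumE.
  under eq_bigr do rewrite -[F _ _]/(evalC q _) rmorph_sum mulr_suml.
  rewrite exchange_big /=.
  have /matrixP AA := congr1 (map_mx (evalC q)) (mul_adj_mx A).
  have -> : \sum_j \sum_i evalC q ((Y (h j) : C) * \adj A j i) * vat (e i) q (h l)
    = \sum_j (Y (h j) : C) q * map_mx (evalC q) (\det A)%:M j l.
    apply: eq_bigr => j _; rewrite -AA map_mxM mxE mulr_sumr.
    by apply: eq_bigr => i _; rewrite rmorphM !mxE mulrA.
  rewrite (bigD1 l) //= big1 => [|j jl]; last by rewrite !mxE (negPf jl) mulr0.
  by rewrite !mxE eqxx addr0 mulrC subrr.
(* Where [D] does not vanish, the [e i] are independent, hence a basis, and a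
   tangent vector that kills all the [h j] is zero. *)
have Zq q : D q != 0 -> vat Z q = 0.
  rewrite Dq -unitfE -unitmxE Aq => U.
  have cA (c : 'I_k -> R) : (forall j, \sum_i c i * (e i (h j) : C) q = 0) ->
      forall i, c i = 0.
    move=> c0 i; have : (\row_j c j) *m (\matrix_(i, j) (e i (h j) : C) q) = 0.
      by apply/rowP => j; rewrite !mxE -[RHS](c0 j); apply: eq_bigr => l _; rewrite !mxE.
    move/(congr1 (mulmx^~ (invmx (\matrix_(i, j) (e i (h j) : C) q)))).
    by rewrite mulmxK // mul0mx => /rowP/(_ i); rewrite !mxE.
  have ieq : independent_at q e.
    move=> c c0; apply: cA => j.
    by move: (congr1 (fun v => v (h j)) c0); rewrite fct_sumE.
  have [e1 be1] := frames q.
  have [c [cE _]] := independent_tangent_basis be1 ieq (vat_tangent Z q).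
  rewrite cE big1 // => i _; rewrite (cA c) ?scale0r // => j.
  by rewrite -[RHS](Zh j q) cE fct_sumE.
have DZ : D *: Z = 0.
  apply: vatP => f q; rewrite -[LHS]/(D q * vat Z q f) -[RHS]/(0 : R).
  have [->|Dq0] := eqVneq (D q) 0; first by rewrite mul0r.
  by rewrite Zq // -[X in _ * X]/(0 : R) mulr0.
pose scM := GRing.isLinear.Build _ _ _ _ _ lphi.
pose psi : {scalar VF} := HB.pack phi scM.
have := congr1 (fun V => psi V p) DZ.
rewrite linearZ linear0 linearB linearZ /= scalar_sum //.
rewrite -[LHS]/(D p * (D p * phi Y p - evalC p (\sum_i F i * phi (e i)))).
rewrite rmorph_sum big1 ?subr0 => [/eqP|i _]; last first.
  rewrite rmorphM rmorph_sum big1 ?mul0r // => j _.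
  rewrite rmorphM [X in X * _](_ : _ = 0) ?mul0r //.
  by rewrite -[RHS]/((0 : C -> R) (h j)) -Y0.
by rewrite !mulf_eq0 (negPf Dp) /= => /eqP.
Qed.

End Tensoriality.

(** * Quaternionic linear algebra

    The identities behind the deformation are polynomial, so they are proved for
    a module over any commutative ring; no division occurs in them. *)

Section ScalarForms.
Variables (C : comPzRingType) (V : lmodType C).
Implicit Types (c : C) (W Y Z : V).

Lemma scalarE (phi : V -> C) : scalar phi ->
  (forall Y Z, phi (Y + Z) = phi Y + phi Z) *
  (forall Y, phi (- Y) = - phi Y) *
  (forall c Y, phi (c *: Y) = c * phi Y) * (phi 0 = 0).
Proof.
move=> lphi; pose scM := GRing.isLinear.Build _ _ _ _ _ lphi.
pose psi : {scalar V} := HB.pack phi scM; rewrite -[phi]/(psi : _ -> _).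
split; last exact: linear0.
by split=> [|c Y]; [split=> [Y Z|Y]; [exact: linearD|exact: linearN]|exact: linearZ].
Qed.

Definition bilinear_scalar (g : V -> V -> C) : Prop :=
  (forall Z, scalar (g^~ Z)) /\ (forall Y, scalar (g Y)).

Lemma formE (g : V -> V -> C) : bilinear_scalar g ->
  (forall Y Z W, g (Y + Z) W = g Y W + g Z W) *
  (forall Y W, g (- Y) W = - g Y W) *
  (forall c Y W, g (c *: Y) W = c * g Y W) *
  (forall W, g 0 W = 0) *
  (forall W Y Z, g W (Y + Z) = g W Y + g W Z) *
  (forall W Y, g W (- Y) = - g W Y) *
  (forall c W Y, g W (c *: Y) = c * g W Y) *
  (forall W, g W 0 = 0).
Proof.
by case=> gl gr; do !split=> *; rewrite ?(scalarE (gl _)) ?(scalarE (gr _)).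
Qed.

End ScalarForms.

Section Quaternionic.
Variables (C : comPzRingType) (V : lmodType C).
Implicit Types (c : C) (W Y Z u v : V) (I J K : {linear V -> V}).

Definition linE I := (linearD I, linearN I, linearZ_LR I).

Definition quaternionic I J K : Prop :=
  forall Y, [/\ I (I Y) = - Y, J (J Y) = - Y, K (K Y) = - Y,
                I (J Y) = K Y & J (I Y) = - K Y].

Lemma quatE I J K : quaternionic I J K ->
  (forall Y, I (I Y) = - Y) * (forall Y, J (J Y) = - Y) *
  (forall Y, K (K Y) = - Y) * (forall Y, I (J Y) = K Y) *
  (forall Y, J (I Y) = - K Y) * (forall Y, J (K Y) = I Y) *
  (forall Y, K (J Y) = - I Y) * (forall Y, K (I Y) = J Y) *
  (forall Y, I (K Y) = - J Y).
Proof.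
move=> q; have II Y : I (I Y) = - Y by case: (q Y).
have JJ Y : J (J Y) = - Y by case: (q Y).
have KK Y : K (K Y) = - Y by case: (q Y).
have IJ Y : I (J Y) = K Y by case: (q Y).
have JI Y : J (I Y) = - K Y by case: (q Y).
have IK Y : I (K Y) = - J Y by rewrite -IJ II.
have JK Y : J (K Y) = I Y by rewrite -[K Y]opprK -JI linearN JJ opprK.
have KJ Y : K (J Y) = - I Y by rewrite -IJ JJ linearN.
have KI Y : K (I Y) = J Y by rewrite -IJ JI linearN IK opprK.
by do !split.
Qed.

Lemma quaternionic_cyc I J K : quaternionic I J K -> quaternionic J K I.
Proof. by move=> q Y; split; rewrite !(quatE q). Qed.

End Quaternionic.

(** The quaternionic operator of rank one built from [u] and [v]: for a form that
    is Hermitian with respect to [I], [J], [K] it commutes with the three of them,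
    and its adjoint is [rank1 v u]. With [u = v = X] it is [g(X, X)] times the
    projection onto the span of [X], [IX], [JX], [KX]. *)
HB.lock Definition rank1 (C : comPzRingType) (V : lmodType C)
    (I J K : {linear V -> V}) (g : V -> V -> C) (u v Z : V) : V :=
  g u Z *: v + g (I u) Z *: I v + g (J u) Z *: J v + g (K u) Z *: K v.

Section Hyperhermitian.
Variables (C : comPzRingType) (V : lmodType C).
Implicit Types (c : C) (W Y Z u v : V).
Variables (I J K : {linear V -> V}) (g : V -> V -> C) (X : V).
Hypotheses (q : quaternionic I J K) (gb : bilinear_scalar g).
Hypothesis gS : forall Y Z, g Y Z = g Z Y.
Hypotheses (hI : forall Y Z, g (I Y) (I Z) = g Y Z).
Hypotheses (hJ : forall Y Z, g (J Y) (J Z) = g Y Z).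
Hypotheses (hK : forall Y Z, g (K Y) (K Z) = g Y Z).

Local Notation rk1 := (rank1 I J K g).

Lemma hermitian_skew A : (forall Y, A (A Y) = - Y) ->
  (forall Y Z, g (A Y) (A Z) = g Y Z) -> forall Y Z, g Y (A Z) = - g (A Y) Z.
Proof. by move=> AA hA Y Z; rewrite -(hA Y) AA (formE gb). Qed.

Lemma hermE :
  (forall Y Z, g Y (I Z) = - g (I Y) Z) * (forall Y Z, g Y (J Z) = - g (J Y) Z) *
  (forall Y Z, g Y (K Z) = - g (K Y) Z).
Proof.
by split; first split; apply: hermitian_skew => // Y; case: (q Y).
Qed.

Lemma rank1E u v Z W : g (rk1 u v Z) W =
  g u Z * g v W + g (I u) Z * g (I v) W + g (J u) Z * g (J v) W
  + g (K u) Z * g (K v) W.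
Proof. by rewrite rank1.unlock !(formE gb). Qed.

Lemma rank1_frameE Z W :
  (g (rk1 X (I X) Z) W = g X Z * g (I X) W - g (I X) Z * g X W
    - g (J X) Z * g (K X) W + g (K X) Z * g (J X) W) *
   (g (rk1 X (J X) Z) W = g X Z * g (J X) W - g (J X) Z * g X W
    - g (K X) Z * g (I X) W + g (I X) Z * g (K X) W) *
   (g (rk1 X (K X) Z) W = g X Z * g (K X) W - g (K X) Z * g X W
    - g (I X) Z * g (J X) W + g (J X) Z * g (I X) W).
Proof. by rewrite !rank1E !(quatE q) !(formE gb); do !split; ring. Qed.

(** In the application [tv] is the function [t / g(X, X)], so the second term is
    [t] times the form of the projection. *)
Definition deform (f tv : C) Y Z : C := f * (g Y Z + tv * g (rk1 X X Y) Z).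

Variables (f tv : C).
Local Notation g' := (deform f tv).

Lemma deformE Y Z : g' Y Z = f * (g Y Z + tv *
  (g X Y * g X Z + g (I X) Y * g (I X) Z + g (J X) Y * g (J X) Z
   + g (K X) Y * g (K X) Z)).
Proof. by rewrite /deform rank1E. Qed.

Lemma deform_bilinear : bilinear_scalar g'.
Proof.
by split=> [Z c Y W|Y c Z W]; rewrite !deformE !(formE gb) /=; ring.
Qed.

Lemma deform_sym Y Z : g' Y Z = g' Z Y.
Proof. by rewrite !deformE [g Y Z]gS; ring. Qed.

Lemma deform_hermitianI Y Z : g' (I Y) (I Z) = g' Y Z.
Proof. by rewrite !deformE hI !hermE !(quatE q) !(formE gb); ring. Qed.

Lemma deform_hermitianJ Y Z : g' (J Y) (J Z) = g' Y Z.
Proof. by rewrite !deformE hJ !hermE !(quatE q) !(formE gb); ring. Qed.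

Lemma deform_hermitianK Y Z : g' (K Y) (K Z) = g' Y Z.
Proof. by rewrite !deformE hK !hermE !(quatE q) !(formE gb); ring. Qed.

Hypothesis oX : (g (I X) X = 0) * (g (J X) X = 0) * (g (K X) X = 0).

Lemma rank1X Y : (g X (rk1 X X Y) = g X X * g X Y) *
  (g (I X) (rk1 X X Y) = g X X * g (I X) Y) *
  (g (J X) (rk1 X X Y) = g X X * g (J X) Y) *
  (g (K X) (rk1 X X Y) = g X X * g (K X) Y).
Proof.
rewrite ![g _ (rk1 _ _ _)]gS !rank1E !hI !hJ !hK.
rewrite ![g _ (I X)]hermE ![g _ (J X)]hermE ![g _ (K X)]hermE.
rewrite !(quatE q) !(formE gb) !oX.
by do !split; ring.
Qed.

(** The inverse of [1 + tv rank1 X X], for the coefficient [w] that solves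
    [w + w tv g(X, X) = tv]; it converts [f g] into [deform f tv]. *)
Definition deform_inv (w : C) Y : V := Y - w *: rk1 X X Y.

Lemma deform_invE w Y Z : w + w * tv * g X X = tv ->
  g' (deform_inv w Y) Z = f * g Y Z.
Proof.
move=> wE; transitivity
  (f * (g Y Z + (tv - (w + w * tv * g X X)) * g (rk1 X X Y) Z)); last first.
  by rewrite wE subrr mul0r addr0.
by rewrite deformE /deform_inv !(formE gb) !rank1X !rank1E; ring.
Qed.

Lemma stretchE w Y Z : g (Y + w *: rk1 X X Y) (Z + w *: rk1 X X Z) =
  g Y Z + (w *+ 2 + w * w * g X X) * g (rk1 X X Y) Z.
Proof.
have e : g Y (rk1 X X Z) = g (rk1 X X Y) Z by rewrite gS !rank1E; ring.
have e2 : g (rk1 X X Y) (rk1 X X Z) = g X X * g (rk1 X X Y) Z.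
  by rewrite !rank1E !rank1X; ring.
by rewrite !(formE gb) e e2; ring.
Qed.

(** If [w] makes the bracket on the right vanish, then [1 + w rank1 X X] is an
    isometry from [f g] to [deform f tv]; this provides orthonormal frames. *)
Lemma deform_stretch w Y Z :
  g' (Y + w *: rk1 X X Y) (Z + w *: rk1 X X Z) =
  f * (g Y Z + (w *+ 2 + w * w * g X X + tv * (1 + w * g X X) * (1 + w * g X X))
               * g (rk1 X X Y) Z).
Proof.
by rewrite deformE stretchE !(formE gb) !rank1X !rank1E; ring.
Qed.

Variables (BI BJ BK : {linear V -> V}).
Hypotheses (BIs : forall Y Z, g Y (BI Z) = - g (BI Y) Z).
Hypotheses (BJs : forall Y Z, g Y (BJ Z) = - g (BJ Y) Z).
Hypotheses (BKs : forall Y Z, g Y (BK Z) = - g (BK Y) Z).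

(** Up to [deform_inv], the difference between the connections of the deformed
    and of the original metric. Each term commutes with [I], [J], [K] in the
    argument [Z]: the rank-one operators do, and so do [BI], [BJ], [BK] in the
    application. The latter enter because the projection term of [g'] pairs with
    the torsion through the contractions [T(AX, _)], which have to be made totally
    skew. *)
Definition correction (p r s b : C) Y Z : V :=
  (p * g X Y) *: Z + r *: rk1 Y X Z + p *: rk1 X Y Z
  + s *: (g X Y *: rk1 X X Z + g (I X) Y *: rk1 X (I X) Z
          + g (J X) Y *: rk1 X (J X) Z + g (K X) Y *: rk1 X (K X) Z)
  + b *: (g (I X) Y *: BI Z + g (J X) Y *: BJ Z + g (K X) Y *: BK Z).

Variables (p r s b : C).
Local Notation S := (correction p r s b).

Lemma correctionE Y Z W : g (S Y Z) W = p * g X Y * g Z W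
  + r * (g Y Z * g X W + g (I Y) Z * g (I X) W + g (J Y) Z * g (J X) W
         + g (K Y) Z * g (K X) W)
  + p * (g X Z * g Y W + g (I X) Z * g (I Y) W + g (J X) Z * g (J Y) W
         + g (K X) Z * g (K Y) W)
  + s * (g X Y * g (rk1 X X Z) W + g (I X) Y * g (rk1 X (I X) Z) W
         + g (J X) Y * g (rk1 X (J X) Z) W + g (K X) Y * g (rk1 X (K X) Z) W)
  + b * (g (I X) Y * g (BI Z) W + g (J X) Y * g (BJ Z) W + g (K X) Y * g (BK Z) W).
Proof. by rewrite /correction !(formE gb) !(rank1E Y) !(rank1E X Y); ring. Qed.

(** The right-hand side is what the derivative of [f (g + tv rank1 X X)] under the
    original connection contributes; the terms in [s] with [rank1 X (AX)] and the
    terms in [b] are skew in [Z], [W] and drop out. *)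
Lemma correction_metric Y Z W : g (S Y Z) W + g Z (S Y W) =
  p *+ 2 * g X Y * g Z W
  + (r + p) * (g Y Z * g X W + g (I Y) Z * g (I X) W + g (J Y) Z * g (J X) W
               + g (K Y) Z * g (K X) W + g X Z * g Y W + g (I X) Z * g (I Y) W
               + g (J X) Z * g (J Y) W + g (K X) Z * g (K Y) W)
  + s *+ 2 * g X Y * (g X Z * g X W + g (I X) Z * g (I X) W
                      + g (J X) Z * g (J X) W + g (K X) Z * g (K X) W).
Proof.
rewrite [g Z _]gS !correctionE !rank1_frameE !rank1E [g W Z]gS.
rewrite -[g (BI W) Z]opprK -BIs -[g (BJ W) Z]opprK -BJs -[g (BK W) Z]opprK -BKs.
by rewrite [g W (BI _)]gS [g W (BJ _)]gS [g W (BK _)]gS; ring.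
Qed.

(** The term in [s] is a cyclic sum in [Y], [Z], [W]. Those in [p] and [b] lack
    their third summand, the one with [W] as an argument of [g(AX, _)]; it comes
    from the torsion of the original connection and, for [p], from the term in
    [r]. *)
Lemma correction_torsion Y Z W : g (S Y Z) W - g (S Z Y) W =
  r *+ 2 * (g (I Y) Z * g (I X) W + g (J Y) Z * g (J X) W
            + g (K Y) Z * g (K X) W)
  - p * (g (I X) Y * g (I Z) W + g (J X) Y * g (J Z) W + g (K X) Y * g (K Z) W)
  - p * (g (I X) Z * g (I W) Y + g (J X) Z * g (J W) Y + g (K X) Z * g (K W) Y)
  + b * (g (I X) Y * g (BI Z) W + g (J X) Y * g (BJ Z) W + g (K X) Y * g (BK Z) W)
  + b * (g (I X) Z * g (BI W) Y + g (J X) Z * g (BJ W) Y + g (K X) Z * g (BK W) Y)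
  - s *+ 2 * (
     g (I X) W * (g (J X) Y * g (K X) Z - g (J X) Z * g (K X) Y)
     + g (I X) Y * (g (J X) Z * g (K X) W - g (J X) W * g (K X) Z)
     + g (I X) Z * (g (J X) W * g (K X) Y - g (J X) Y * g (K X) W)).
Proof.
have sk (A : {linear V -> V}) Y1 Z1 :
    (forall Y Z, g Y (A Z) = - g (A Y) Z) -> g (A Z1) Y1 = - g (A Y1) Z1.
  by move=> sA; rewrite gS sA.
have [[sI sJ] sK] := hermE.
rewrite !correctionE !rank1_frameE !rank1E [g Z Y]gS.
rewrite (sk BI Y W) // (sk BJ Y W) // (sk BK Y W) //.
rewrite (sk I Y W) // (sk J Y W) // (sk K Y W) //.
rewrite (sk I Y Z) // (sk J Y Z) // (sk K Y Z) //.
ring.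
Qed.

End Hyperhermitian.

(** * Three-forms and orthonormal frames *)

Section Forms.
Variables (R : realType) (n : nat) (M : smoothManifold R n).
Local Notation C := (Cinf M).
Local Notation VF := (vectorField M).
Implicit Types (f h : C) (W Y Z : VF) (p q : M).

Lemma definite_nondegenerate (g : VF -> VF -> C) Y :
  definite g -> (forall Z, g Y Z = 0) -> Y = 0.
Proof.
move=> dg Y0; apply: vatP => f p.
suff -> : vat Y p = 0 by [].
apply: contrapT => Yp; have gYp : g Y Y p = 0 by rewrite Y0.
by case: dg => /(_ p Y Yp); rewrite gYp ltxx.
Qed.

Lemma eq_three_form (c d : VF -> VF -> VF -> C) :
  (forall W Y Z, c W Y Z = d W Y Z) -> three_form d -> three_form c.
Proof. by move=> cd; have -> : c = d by do 3!apply/funext => ?. Qed.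

Lemma three_formD (c d : VF -> VF -> VF -> C) : three_form c -> three_form d ->
  three_form (fun W Y Z => c W Y Z + d W Y Z).
Proof.
case=> c1 c2 c3 c0 [d1 d2 d3 d0]; split.
- by move=> Y Z u V W; rewrite (c1 Y Z) (d1 Y Z); ring.
- by move=> Y Z u V W; rewrite (c2 Y Z) (d2 Y Z); ring.
- by move=> Y Z u V W; rewrite (c3 Y Z) (d3 Y Z); ring.
- move=> W Y; have [-> -> ->] := c0 W Y; have [-> -> ->] := d0 W Y.
  by rewrite !addr0.
Qed.

Lemma three_formZ (f : C) (c : VF -> VF -> VF -> C) : three_form c ->
  three_form (fun W Y Z => f * c W Y Z).
Proof.
case=> c1 c2 c3 c0; split.
- by move=> Y Z u V W; rewrite (c1 Y Z) /=; ring.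
- by move=> Y Z u V W; rewrite (c2 Y Z) /=; ring.
- by move=> Y Z u V W; rewrite (c3 Y Z) /=; ring.
- by move=> W Y; have [-> -> ->] := c0 W Y; rewrite !mulr0.
Qed.

(** The wedge product of a one-form and a two-form, without a normalization
    factor. *)
Definition wedge12 (x : VF -> C) (be : VF -> VF -> C) (W Y Z : VF) : C :=
  x W * be Y Z + x Y * be Z W + x Z * be W Y.

Lemma three_form_wedge12 x be : scalar x -> bilinear_form be ->
  (forall Y Z, be Z Y = - be Y Z) -> (forall Y, be Y Y = 0) ->
  three_form (wedge12 x be).
Proof.
move=> lx bb bS b0; rewrite /wedge12; split.
- by move=> Y Z u V W; rewrite !(scalarE lx) !(formE bb) /=; ring.
- by move=> Y Z u V W; rewrite !(scalarE lx) !(formE bb) /=; ring.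
- by move=> Y Z u V W; rewrite !(scalarE lx) !(formE bb) /=; ring.
- by move=> W Y; rewrite !b0 (bS W Y); split; ring.
Qed.

Lemma three_form_skew (c : VF -> VF -> VF -> C) : three_form c ->
  ((forall W Y Z, c Y W Z = - c W Y Z) * (forall W Y Z, c W Z Y = - c W Y Z)).
Proof.
case=> c1 c2 c3 c0; split=> W Y Z.
  have [e _ _] := c0 (W + Y) Z; have [eW _ _] := c0 W Z; have [eY _ _] := c0 Y Z.
  move: e; rewrite (scalarE (c1 _ _)) !(scalarE (c2 _ _)) eW eY add0r addr0.
  by move/eqP; rewrite addr_eq0 => /eqP ->; rewrite opprK.
have [_ e _] := c0 W (Y + Z); have [_ eY _] := c0 W Y; have [_ eZ _] := c0 W Z.
move: e; rewrite (scalarE (c2 _ _)) !(scalarE (c3 _ _)) eY eZ add0r addr0.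
by move/eqP; rewrite addr_eq0 => /eqP ->; rewrite opprK.
Qed.

(** Fields that are orthogonal with nonzero squares at [p] are independent there,
    because the values of [g] at [p] depend on the values of the fields only. *)
Lemma orthonormal_tangent_basis k p (e e' : 'I_k -> VF) (g : VF -> VF -> C)
    (s : 'I_k -> R) :
  (forall q, exists e : 'I_k -> VF, tangent_basis q e) -> bilinear_form g ->
  tangent_basis p e -> (forall i, s i != 0) ->
  (forall i j, g (e' i) (e' j) p = if i == j then s i else 0) ->
  tangent_basis p e'.
Proof.
move=> fr gb be s0 orth; apply: (independent_tangent_basis be) => c c0 j.
pose V : VF := \sum_i (c i *: (1 : C)) *: e' i.
have Vp : vat V p = 0.
  rewrite -c0; apply/funext => f; rewrite fct_sumE /V.
  elim/big_rec2: _ => [//|i x y _ <-].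
  by rewrite !vatE !CinfE mulr1.
have [gl gr] := gb; have := tensorial fr (gl (e' j)) Vp.
rewrite /V (scalar_sum _ _ (gl (e' j))) -[LHS]/(evalC p _) rmorph_sum (bigD1 j) //=.
rewrite big1 => [|i ij]; last first.
  by rewrite -[LHS]/(c i * 1 * g (e' i) (e' j) p) orth (negPf ij) mulr0.
rewrite addr0 -[LHS]/(c j * 1 * g (e' j) (e' j) p) orth eqxx mulr1 => /eqP.
by rewrite mulf_eq0 (negPf (s0 j)) orbF => /eqP.
Qed.

End Forms.

(** * Torsion of a metric connection with skew torsion *)

Section Rank1.
Variables (R : realType) (n : nat) (M : smoothManifold R n).
Local Notation C := (Cinf M).
Local Notation VF := (vectorField M).
Implicit Types (h F : C) (W Y Z u v : VF).
Variables (I J K : {linear VF -> VF}) (g : VF -> VF -> C).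
Hypotheses (q : quaternionic I J K) (gb : bilinear_form g).
Hypotheses (hI : Defs.hermitian I g) (hJ : Defs.hermitian J g).
Hypothesis hK : Defs.hermitian K g.

Local Notation hE := (hermE q gb hI hJ hK).

Lemma rank1I u v Z : rank1 I J K g u v (I Z) = I (rank1 I J K g u v Z).
Proof.
rewrite rank1.unlock !hE !(linE I) !(quatE q) !(formE gb).
by apply: vatP => f p; rewrite !vatE !CinfE; ring.
Qed.

Lemma rank1J u v Z : rank1 I J K g u v (J Z) = J (rank1 I J K g u v Z).
Proof.
rewrite rank1.unlock !hE !(linE J) !(quatE q) !(formE gb).
by apply: vatP => f p; rewrite !vatE !CinfE; ring.
Qed.

Lemma rank1K u v Z : rank1 I J K g u v (K Z) = K (rank1 I J K g u v Z).
Proof.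
rewrite rank1.unlock !hE !(linE K) !(quatE q) !(formE gb).
by apply: vatP => f p; rewrite !vatE !CinfE; ring.
Qed.

Lemma rank1_linear u v : linear (rank1 I J K g u v).
Proof.
move=> h Y Z; rewrite rank1.unlock !(formE gb).
by apply: vatP => f p; rewrite !vatE !CinfE; ring.
Qed.

Lemma rank1_linear_source v Z : linear (fun u => rank1 I J K g u v Z).
Proof.
move=> h Y W; rewrite rank1.unlock !(linE I) !(linE J) !(linE K) !(formE gb).
by apply: vatP => f p; rewrite !vatE !CinfE; ring.
Qed.

Lemma rank1_linear_target u Z : linear (fun v => rank1 I J K g u v Z).
Proof.
move=> h Y W; rewrite rank1.unlock !(linE I) !(linE J) !(linE K).
by apply: vatP => f p; rewrite !vatE; ring.
Qed.

End Rank1.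

Section TorsionFacts.
Variables (R : realType) (n : nat) (M : smoothManifold R n).
Local Notation C := (Cinf M).
Local Notation VF := (vectorField M).
Implicit Types (V W Y Z : VF) (I : {linear VF -> VF}).
Variables (g : VF -> VF -> C) (nabla : VF -> VF -> VF).
Hypotheses (gb : bilinear_form g) (gS : forall Y Z, g Y Z = g Z Y).
Hypothesis ng : parallel_metric nabla g.
Hypothesis tors : three_form (fun W Y Z => g W (torsion nabla Y Z)).

Local Notation T := (torsion nabla).

Lemma torsion_anti Y Z : T Z Y = - T Y Z.
Proof.
apply: vatP => f p; rewrite /torsion !vatE /vat !bracketE !CinfE; ring.
Qed.

Lemma bracket_torsion Y Z : bracket Y Z = nabla Y Z - nabla Z Y - T Y Z.
Proof. by rewrite /torsion subKr. Qed.

Lemma torsion_skew V Y Z : g Z (T V Y) = - g Y (T V Z).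
Proof.
have [s1 s2] := three_form_skew tors.
by rewrite (s2 Z Y V) (s1 Y Z V) (s2 Y V Z) opprK.
Qed.

Lemma torsion_cyc V Y Z : g V (T Y Z) = g Z (T V Y).
Proof.
by rewrite torsion_skew torsion_anti (formE gb) opprK.
Qed.

(** Total skewness makes the torsion drop out of the Lie derivative of the
    metric. *)
Lemma lie_metricE V Y Z :
  lie_metric V g Y Z = g (nabla Y V) Z + g Y (nabla Z V).
Proof.
rewrite /lie_metric ng !bracket_torsion.
have := torsion_skew V Y Z; rewrite gS; move: (T V Y) (T V Z) => TY TZ tk.
by rewrite !(formE gb) tk; ring.
Qed.

Lemma lie_endoE I V Y : parallel_endo nabla I -> lie_endo V I Y =
  I (nabla Y V) - nabla (I Y) V + (I (T V Y) - T V (I Y)).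
Proof.
move=> pI; rewrite /lie_endo !bracket_torsion pI.
move: (T V Y) (T V (I Y)) => TY TIY; rewrite !(linE I).
by apply: vatP => f p; rewrite !vatE; ring.
Qed.

End TorsionFacts.

(** * Special homotheties of an HKT metric *)

Section Homothety.
Variables (R : realType) (n : nat) (M : smoothManifold R n).
Local Notation C := (Cinf M).
Local Notation VF := (vectorField M).
Local Notation cstC a := (a *: (1 : C)).
Implicit Types (f h : C) (V W Y Z u v : VF) (p : M).
Variables (g : VF -> VF -> C) (nabla : VF -> VF -> VF).
Hypotheses (gb : bilinear_form g) (gS : forall Y Z, g Y Z = g Z Y).
Hypotheses (dg : definite g).
Hypothesis ng : parallel_metric nabla g.
Hypothesis tors : three_form (fun W Y Z => g W (torsion nabla Y Z)).
Variables (a b : R) (X : VF).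

Local Notation T := (torsion nabla).

(** For [S := nabla X - a/2], the homothety condition makes [S] skew and the
    three Killing conditions make [S] anticommute with [I], [J] and [K]; but
    [K = I J] commutes with what anticommutes with [I] and [J]. *)
Lemma nabla_homothety (I J K : {linear VF -> VF}) : quaternionic I J K ->
  Defs.hermitian I g -> Defs.hermitian J g -> Defs.hermitian K g ->
  parallel_endo nabla I -> parallel_endo nabla J -> parallel_endo nabla K ->
  (forall Y Z, lie_metric X g Y Z = a *: g Y Z) ->
  (forall Y Z, [/\ lie_metric (I X) g Y Z = 0, lie_metric (J X) g Y Z = 0 &
                   lie_metric (K X) g Y Z = 0]) ->
  forall Y, nabla Y X = cstC (a / 2) *: Y.
Proof.
move=> q hI hJ hK pI pJ pK LX LQ.
have mE := lie_metricE gb gS ng tors; have hE := hermE q gb hI hJ hK.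
pose D Y := nabla Y X.
have D1 Y Z : g Y (D Z) = a *: g Y Z - g (D Y) Z by rewrite -LX mE addrC addKr.
pose S Y := D Y - cstC (a / 2) *: Y.
have anti (A : {linear VF -> VF}) : (forall Y, A (A Y) = - Y) ->
    (forall Y Z, g Y (A Z) = - g (A Y) Z) -> parallel_endo nabla A ->
    (forall Y Z, lie_metric (A X) g Y Z = 0) -> forall Y, S (A Y) = - A (S Y).
  move=> AA sA pA LA Y.
  have AD Z : g (A (D Y)) Z = g (A Y) (D Z).
    have := LA Y Z; rewrite mE !pA sA => /eqP; rewrite subr_eq0.
    by move/eqP.
  apply/eqP; rewrite -subr_eq0 opprK; apply/eqP.
  apply: (definite_nondegenerate dg) => Z.
  rewrite /S; have := AD Z; have := D1 (A Y) Z; move: (D Y) (D (A Y)) (D Z).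
  move=> DY DAY DZ e1 e2; rewrite !(linE A) !(formE gb) e2 e1.
  by apply: CinfP => p; rewrite !CinfE; field.
have SI := anti I _ _ pI; have SJ := anti J _ _ pJ; have SK := anti K _ _ pK.
move=> Y.
have SIY Z : S (I Z) = - I (S Z).
  by apply: SI => [{}Z|{}Z W|{}Z W]; [case: (q Z)|rewrite hE|case: (LQ Z W)].
have SJY Z : S (J Z) = - J (S Z).
  by apply: SJ => [{}Z|{}Z W|{}Z W]; [case: (q Z)|rewrite hE|case: (LQ Z W)].
have SKY Z : S (K Z) = - K (S Z).
  by apply: SK => [{}Z|{}Z W|{}Z W]; [case: (q Z)|rewrite hE|case: (LQ Z W)].
have KS : K (S Y) = 0.
  have := SKY Y; have [_ _ _ <- _] := q Y; have [_ _ _ IJ _] := q (S Y).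
  rewrite SIY SJY linearN opprK IJ => KK.
  apply: vatP => f p; have := congr1 (fun V => vat V p f) KK; rewrite !vatE.
  by move=> e; lra.
apply/eqP; rewrite -subr_eq0; apply/eqP; rewrite -/(D Y) -/(S Y).
by rewrite -[S Y]opprK; have [_ _ <- _ _] := q (S Y); rewrite KS linear0 oppr0.
Qed.

Hypothesis nX : forall Y, nabla Y X = cstC (a / 2) *: Y.

Lemma derive_sqnorm Y : Y (g X X) = a *: g X Y.
Proof.
rewrite ng !nX !(formE gb) [g Y X]gS.
by apply: CinfP => p; rewrite !CinfE; field.
Qed.

(** Here [a g(X, _)] is the differential of [g(X, X)], hence closed, while its
    exterior derivative is [a] times the contraction of the torsion with [X]. *)
Lemma torsion_homothety Y : a != 0 -> T X Y = 0.
Proof.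
move=> a0; apply: (definite_nondegenerate dg) => Z.
rewrite gS -(torsion_cyc gb tors).
have := bracketE Y Z (g X X); rewrite !derive_sqnorm !vf_scale !ng !nX => e.
apply: CinfP => p; have := congr1 (fun f : C => f p) e.
rewrite /torsion !(formE gb) [g Z Y]gS !CinfE mulr1 => e1.
apply: (mulfI a0); rewrite mulr0.
by rewrite 2!mulrBr e1; ring.
Qed.

(** The multiple of [A] compensates the commutators of [T(AX, _)] with the other
    complex structures, which are [a + b] times the third one. *)
Definition centralizing_torsion (A : {linear VF -> VF}) Y : VF :=
  T (A X) Y + cstC ((a + b) / 2) *: A Y.

Lemma centralizing_torsionP (I J K : {linear VF -> VF}) : quaternionic I J K ->
  parallel_endo nabla I -> parallel_endo nabla J ->
  (forall Y, lie_endo (I X) I Y = 0) ->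
  (forall Y, lie_endo (I X) J Y = cstC b *: K Y) ->
  forall Y, [/\ centralizing_torsion I (I Y) = I (centralizing_torsion I Y),
                centralizing_torsion I (J Y) = J (centralizing_torsion I Y) &
                centralizing_torsion I (K Y) = K (centralizing_torsion I Y)].
Proof.
move=> q pI pJ LII LIJ; set B := centralizing_torsion I.
have BI Y : B (I Y) = I (B Y).
  have := LII Y; rewrite (lie_endoE _ _ pI) !pI !nX /B /centralizing_torsion.
  move: (T _ Y) (T _ (I Y)) => TY TIY; rewrite !(linE I) subrr add0r.
  by move/eqP; rewrite subr_eq0 => /eqP ->.
have BJ Y : B (J Y) = J (B Y).
  have := LIJ Y; rewrite (lie_endoE _ _ pJ) !pI !nX /B /centralizing_torsion.
  move: (T _ Y) (T _ (J Y)) => TY TJY.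
  rewrite !(linE I) !(linE J) !(quatE q) => e.
  apply: vatP => f p; have := congr1 (fun V => vat V p f) e.
  by rewrite !vatE !CinfE => e1; lra.
move=> Y; split=> //; have [_ _ _ <- _] := q Y.
by rewrite BI BJ; have [_ _ _ -> _] := q (B Y).
Qed.

Lemma centralizing_torsion_skew (A : {linear VF -> VF}) :
  (forall Y Z, g Y (A Z) = - g (A Y) Z) ->
  forall Y Z, g Z (centralizing_torsion A Y) = - g Y (centralizing_torsion A Z).
Proof.
move=> sA Y Z; rewrite /centralizing_torsion.
have := torsion_skew tors (A X) Y Z; move: (T _ Y) (T _ Z) => TY TZ tk.
by rewrite !(formE gb) tk !sA [g (A Y) Z]gS sA; ring.
Qed.

Lemma torsion_linear V : linear (T V).
Proof.
move=> h Y Z; apply/eqP; rewrite -subr_eq0; apply/eqP.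
apply: (definite_nondegenerate dg) => W.
have [_ _ t3 _] := tors.
have : g W (T V (h *: Y + Z)) = h * g W (T V Y) + g W (T V Z) by exact: t3.
move: (T V _) (T V Y) (T V Z) => TS TY TZ; rewrite gS !(formE gb) => ->.
by rewrite [g TY W]gS [g TZ W]gS; ring.
Qed.

Lemma centralizing_torsion_linear (A : {linear VF -> VF}) :
  linear (centralizing_torsion A).
Proof.
move=> h Y Z; rewrite /centralizing_torsion torsion_linear.
move: (T _ Y) (T _ Z) => TY TZ; rewrite !(linE A).
by apply: vatP => F p; rewrite !vatE !CinfE; ring.
Qed.

Lemma torsion_centralizing (A : {linear VF -> VF}) Y Z : g (A X) (T Y Z) =
  g (centralizing_torsion A Y) Z - cstC ((a + b) / 2) * g (A Y) Z.
Proof.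
rewrite (torsion_cyc gb tors) gS /centralizing_torsion; move: (T _ _) => TY.
by rewrite !(formE gb); ring.
Qed.

End Homothety.

(** * The deformed metric at a point *)

Section Deformation.
Variables (R : realType) (n : nat) (M : smoothManifold R n).
Local Notation C := (Cinf M).
Local Notation VF := (vectorField M).
Local Notation cstC a := (a *: (1 : C)).
Implicit Types (h F : C) (V W Y Z u v : VF).
Variables (I J K : {linear VF -> VF}) (g : VF -> VF -> C) (X : VF).
Hypotheses (q : quaternionic I J K) (gb : bilinear_form g).
Hypothesis gS : forall Y Z, g Y Z = g Z Y.
Hypotheses (hI : Defs.hermitian I g) (hJ : Defs.hermitian J g).
Hypothesis hK : Defs.hermitian K g.

Local Notation rk1 := (rank1 I J K g).
Local Notation hE := (hermE q gb hI hJ hK).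

Lemma quaternionic_frame_orthogonal :
  (g (I X) X = 0) * (g (J X) X = 0) * (g (K X) X = 0).
Proof.
have z (A : {linear VF -> VF}) :
    (forall Y Z, g Y (A Z) = - g (A Y) Z) -> g (A X) X = 0.
  move=> sA; have := sA X X; rewrite gS => e.
  apply: CinfP => p; have ep := congr1 (fun h : C => h p) e.
  by rewrite CinfE in ep; rewrite -[RHS]/(0 : R); lra.
by split; first split; apply: z => Y Z; rewrite hE.
Qed.

Local Notation oX := quaternionic_frame_orthogonal.

Section Pointwise.
Variables (t : R) (f iv : C).
Hypotheses (nu0 : forall p, g X X p != 0) (ivE : forall p, iv p = (g X X p)^-1).
Hypothesis f0 : forall p, 0 < f p.
Variable k : nat.
Hypothesis frames : forall p, exists e : 'I_k -> VF, tangent_basis p e.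
Hypothesis t1 : 0 < 1 + t.

Local Notation g' := (deform I J K g X f (cstC t * iv)).

(** [g'] is [f (g + t P)] with [P] the [g]-orthogonal projection to the span of
    [X], [IX], [JX], [KX]; so on this span [g'] is [f (1 + t) g], and on its
    orthogonal complement it is [f g]. *)
Lemma deform_definite_signed (eps : R) :
  (forall p Y, vat Y p <> 0 -> 0 < eps * g Y Y p) ->
  forall p Y, vat Y p <> 0 -> 0 < eps * g' Y Y p.
Proof.
move=> gpos p Y Yp.
have psd Z : 0 <= eps * g Z Z p.
  have [Zp|Zp] := pselect (vat Z p = 0); last exact/ltW/gpos.
  by have [gl gr] := gb; rewrite (tensorial frames (gr Z) Zp) mulr0.
have GY := gpos p Y Yp; have nup := nu0 p.
have nu_ge0 := psd X.
pose S := iv p * g (rk1 X X Y) Y p.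
have S0 : 0 <= eps * S.
  have -> : eps * S = g (rk1 X X Y) Y p * (eps * g X X p) / g X X p ^+ 2.
    by rewrite /S ivE; field.
  rewrite divr_ge0 ?sqr_ge0 // mulr_ge0 // (rank1E I J K gb) !CinfE.
  by rewrite -!expr2 !addr_ge0 ?sqr_ge0.
(* [S] is the square of the projection of [Y], and [Y - iv rank1 X X Y] is its
   component orthogonal to the span. *)
have psdY := psd (Y + (- iv) *: rk1 X X Y).
rewrite (stretchE q gb gS hI hJ hK oX) mulr2n !CinfE ivE in psdY.
have {}psdY : 0 <= eps * g Y Y p - eps * S.
  move: psdY; congr (0 <= _); rewrite /S ivE; by field.
have -> : eps * g' Y Y p = f p * (eps * g Y Y p + t * (eps * S)).
  by rewrite /deform !CinfE /S; ring.
apply: mulr_gt0 => //; move: (eps * g Y Y p) (eps * S) psdY S0 GY => G s Gs s0 G0.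
have [t0|t0] := lerP 0 t; first by have := mulr_ge0 t0 s0; lra.
have tGs : 0 <= - t * (G - s) by rewrite mulr_ge0 // oppr_ge0 ltW.
by have := mulr_gt0 t1 G0; lra.
Qed.

Lemma deform_signature (m1 m2 : nat) : k = (m1 + m2)%N ->
  has_signature m1 m2 g -> has_signature m1 m2 g'.
Proof.
move=> km sg p; have [e [be orth]] := sg p; subst k.
pose c := Num.sqrt (1 + t); pose d := Num.sqrt (f p).
have c0 : c != 0 by rewrite gt_eqF // sqrtr_gt0.
have d0 : d != 0 by rewrite gt_eqF // sqrtr_gt0.
have cE : t = c ^+ 2 - 1 by rewrite sqr_sqrtr ?ltW //; ring.
have dE : f p = d ^+ 2 by rewrite sqr_sqrtr ?ltW.
(* The square root of [1 + t P] carries a [g]-orthonormal frame to a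
   [g']-orthonormal one, up to the conformal factor. *)
pose w := cstC (c^-1 - 1) * iv.
pose e' i := cstC d^-1 *: (e i + w *: rk1 X X (e i)).
have gb' : bilinear_form g' := deform_bilinear I J K X gb f (cstC t * iv).
have orth' i j : g' (e' i) (e' j) p = g (e i) (e j) p.
  rewrite /e' ((formE gb').1.1.1.1.1.2) ((formE gb').1.2).
  rewrite (deform_stretch q gb gS hI hJ hK _ _ oX) mulr2n /w !CinfE ivE dE cE.
  by move: (nu0 p) => nup; field; rewrite nup c0 d0.
exists e'; split; last by move=> i j; rewrite orth' orth.
apply: (orthonormal_tangent_basis frames gb' be
  (s := fun i => if (i < m1)%N then 1 else -1)) => [i|i j].
  by case: ifP; rewrite ?oppr_eq0 oner_eq0.
by rewrite orth' orth.
Qed.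

End Pointwise.
End Deformation.

(** * The HKT connection of the deformed metric *)

Section DeformConnection.
Variables (R : realType) (n : nat) (M : smoothManifold R n).
Local Notation C := (Cinf M).
Local Notation VF := (vectorField M).
Implicit Types (h F : C) (V W Y Z u v : VF).
Variables (I J K : {linear VF -> VF}) (g : VF -> VF -> C) (X : VF).
Hypotheses (q : quaternionic I J K) (gb : bilinear_form g).
Hypothesis gS : forall Y Z, g Y Z = g Z Y.
Hypotheses (hI : Defs.hermitian I g) (hJ : Defs.hermitian J g).
Hypothesis hK : Defs.hermitian K g.
Variables (nabla : VF -> VF -> VF) (BI BJ BK : {linear VF -> VF}).
Hypotheses (cn : connection nabla) (ng : parallel_metric nabla g).
Hypotheses (pI : parallel_endo nabla I) (pJ : parallel_endo nabla J).
Hypothesis pK : parallel_endo nabla K.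
Hypothesis tors : three_form (fun W Y Z => g W (torsion nabla Y Z)).
Hypothesis BIc : forall Y, [/\ BI (I Y) = I (BI Y), BI (J Y) = J (BI Y) &
                               BI (K Y) = K (BI Y)].
Hypothesis BJc : forall Y, [/\ BJ (I Y) = I (BJ Y), BJ (J Y) = J (BJ Y) &
                               BJ (K Y) = K (BJ Y)].
Hypothesis BKc : forall Y, [/\ BK (I Y) = I (BK Y), BK (J Y) = J (BK Y) &
                               BK (K Y) = K (BK Y)].
Hypothesis BIs : forall Y Z, g Y (BI Z) = - g (BI Y) Z.
Hypothesis BJs : forall Y Z, g Y (BJ Z) = - g (BJ Y) Z.
Hypothesis BKs : forall Y Z, g Y (BK Z) = - g (BK Y) Z.
Variables (ca ch : C).
Hypothesis nX : forall Y, nabla Y X = ca *: Y.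
Hypothesis TX : forall Y Z, g X (torsion nabla Y Z) = 0.
Hypothesis TIX : forall Y Z,
  g (I X) (torsion nabla Y Z) = g (BI Y) Z - ch * g (I Y) Z.
Hypothesis TJX : forall Y Z,
  g (J X) (torsion nabla Y Z) = g (BJ Y) Z - ch * g (J Y) Z.
Hypothesis TKX : forall Y Z,
  g (K X) (torsion nabla Y Z) = g (BK Y) Z - ch * g (K Y) Z.
Variables (f tv w p r s : C).
Hypothesis wE : w + w * tv * g X X = tv.
Hypothesis df : forall Y, Y f = p *+ 2 * f * g X Y.
Hypothesis dtv : forall Y, Y tv = (s *+ 2 - p *+ 2 * tv) * g X Y.
Hypothesis rpE : r + p = ca * tv.
Hypothesis rE : r *+ 2 = ch * tv - p.

Local Notation rk1 := (rank1 I J K g).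
Local Notation g' := (deform I J K g X f tv).
Local Notation corr := (correction I J K g X BI BJ BK p r s tv).
Local Notation inv := (deform_inv I J K g X w).
Local Notation oX := (quaternionic_frame_orthogonal X q gb gS hI hJ hK).

Definition deform_nabla Y Z : VF := nabla Y Z + inv (corr Y Z).

Lemma deform_inv_linear : linear inv.
Proof.
move=> h V W; rewrite /deform_inv (rank1_linear I J K gb).
by apply: vatP => F x; rewrite !vatE; ring.
Qed.

Lemma correction_linearl Z : linear (corr^~ Z).
Proof.
move=> h V W; rewrite /correction (rank1_linear_source I J K gb).
rewrite (rank1_linear_target I J K g) !(formE gb).
by apply: vatP => F x; rewrite !vatE !CinfE; ring.
Qed.

Lemma correction_linearr Y : linear (corr Y).
Proof.
move=> h V W; rewrite /correction !(rank1_linear I J K gb).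
rewrite (linearP BI) (linearP BJ) (linearP BK).
by apply: vatP => F x; rewrite !vatE !CinfE; ring.
Qed.

Lemma correctionI Y Z : corr Y (I Z) = I (corr Y Z).
Proof.
rewrite /correction !(rank1I q gb hI hJ hK) !(linE I).
by have [-> _ _] := BIc Z; have [-> _ _] := BJc Z; have [-> _ _] := BKc Z.
Qed.

Lemma correctionJ Y Z : corr Y (J Z) = J (corr Y Z).
Proof.
rewrite /correction !(rank1J q gb hI hJ hK) !(linE J).
by have [_ -> _] := BIc Z; have [_ -> _] := BJc Z; have [_ -> _] := BKc Z.
Qed.

Lemma correctionK Y Z : corr Y (K Z) = K (corr Y Z).
Proof.
rewrite /correction !(rank1K q gb hI hJ hK) !(linE K).
by have [_ _ ->] := BIc Z; have [_ _ ->] := BJc Z; have [_ _ ->] := BKc Z.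
Qed.

Lemma deform_invI V : inv (I V) = I (inv V).
Proof. by rewrite /deform_inv (rank1I q gb hI hJ hK) !(linE I). Qed.

Lemma deform_invJ V : inv (J V) = J (inv V).
Proof. by rewrite /deform_inv (rank1J q gb hI hJ hK) !(linE J). Qed.

Lemma deform_invK V : inv (K V) = K (inv V).
Proof. by rewrite /deform_inv (rank1K q gb hI hJ hK) !(linE K). Qed.

Lemma deform_connection : connection deform_nabla.
Proof.
have [c1 c2 c3] := cn; rewrite /deform_nabla; split.
- move=> Z h V W; rewrite c1 (correction_linearl Z) deform_inv_linear.
  by cbv beta; rewrite [in RHS]scalerDr addrACA.
- move=> Y V W; cbv beta; rewrite c2.
  have := correction_linearr Y 1 V W; rewrite !scale1r => ->.
  have := deform_inv_linear 1 (corr Y V) (corr Y W); rewrite !scale1r => ->.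
  by rewrite addrACA.
move=> Y h Z; rewrite c3.
have := correction_linearr Y h Z 0; have := correction_linearr Y (-1) 0 0.
rewrite !scaleN1r oppr0 !addr0 addNr => ->; rewrite addr0 => ->.
have := deform_inv_linear h (corr Y Z) 0; have := deform_inv_linear (-1) 0 0.
rewrite !scaleN1r oppr0 !addr0 addNr => ->; rewrite addr0 => ->.
by rewrite [in RHS]scalerDr addrA.
Qed.

Lemma deform_parallelI : parallel_endo deform_nabla I.
Proof.
by move=> Y Z; rewrite /deform_nabla pI correctionI deform_invI [in RHS](linearD I).
Qed.

Lemma deform_parallelJ : parallel_endo deform_nabla J.
Proof.
by move=> Y Z; rewrite /deform_nabla pJ correctionJ deform_invJ [in RHS](linearD J).
Qed.

Lemma deform_parallelK : parallel_endo deform_nabla K.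
Proof.
by move=> Y Z; rewrite /deform_nabla pK correctionK deform_invK [in RHS](linearD K).
Qed.

Lemma deform_parallel : parallel_metric deform_nabla g'.
Proof.
move=> Y Z W; have gb' : bilinear_form g' := deform_bilinear I J K X gb f tv.
have sE V V' := deform_invE q gb gS hI hJ hK f oX (tv := tv) V V' wE.
rewrite /deform_nabla (((formE gb').1.1.1.1.1.1.1) (nabla Y Z)).
rewrite (((formE gb').1.1.1.2) Z) [g' Z (inv _)](deform_sym I J K X gb gS) !sE.
transitivity (g' (nabla Y Z) W + g' Z (nabla Y W) +
  f * (g (corr Y Z) W + g Z (corr Y W))); last by rewrite [g Z (corr _ _)]gS; ring.
rewrite (correction_metric X q gb gS BIs BJs BKs) rpE.
rewrite !(deformE I J K X gb) vfM vf_add vfM !vf_add !vfM df dtv !ng pI pJ pK nX.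
rewrite !(linE I) !(linE J) !(linE K) !(formE gb).
ring.
Qed.

(** Each of the four contributions is visibly a three-form. The hypothesis on [r]
    is the condition under which the terms with [g(A _, _)] combine to one. *)
Lemma deform_torsion W Y Z : g' W (torsion deform_nabla Y Z) =
  f * (g W (torsion nabla Y Z)
       + tv * (wedge12 (g (I X)) (fun Y => g (BI Y)) W Y Z
               + wedge12 (g (J X)) (fun Y => g (BJ Y)) W Y Z
               + wedge12 (g (K X)) (fun Y => g (BK Y)) W Y Z)
       + (- p) * (wedge12 (g (I X)) (fun Y => g (I Y)) W Y Z
               + wedge12 (g (J X)) (fun Y => g (J Y)) W Y Z
               + wedge12 (g (K X)) (fun Y => g (K Y)) W Y Z)
       + (- s *+ 2) * wedge12 (g (I X))
          (fun Y Z => g (J X) Y * g (K X) Z - g (J X) Z * g (K X) Y) W Y Z).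
Proof.
have gb' : bilinear_form g' := deform_bilinear I J K X gb f tv.
have sE V V' := deform_invE q gb gS hI hJ hK f oX (tv := tv) V V' wE.
have TE : torsion deform_nabla Y Z =
    torsion nabla Y Z + (inv (corr Y Z) - inv (corr Z Y)).
  rewrite /torsion /deform_nabla; move: (inv (corr Y Z)) (inv (corr Z Y)) => V1 V2.
  by rewrite opprD [X in X - bracket _ _ = _]addrACA [LHS]addrAC.
have := TX Y Z; have := TIX Y Z; have := TJX Y Z; have := TKX Y Z.
rewrite TE; move: (torsion nabla Y Z) => TYZ tK tJ tI tX.
rewrite (deform_sym I J K X gb gS) (((formE gb').1.1.1.1.1.1.1) TYZ).
rewrite (((formE gb').1.1.1.1.1.1.1) (inv _)) ((formE gb').1.1.1.1.1.1.2) !sE.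
transitivity (g' TYZ W + f * (g (corr Y Z) W - g (corr Z Y) W)); first by ring.
rewrite (correction_torsion X q gb gS hI hJ hK BIs BJs BKs) rE (deformE I J K X gb).
by rewrite tX tI tJ tK [g TYZ W]gS /wedge12; ring.
Qed.

Lemma deform_torsion_three_form :
  three_form (fun W Y Z => g' W (torsion deform_nabla Y Z)).
Proof.
have [[sI sJ] sK] := hermE q gb hI hJ hK.
have w3 (A : {linear VF -> VF}) V : (forall Y Z, g Y (A Z) = - g (A Y) Z) ->
    three_form (wedge12 (g V) (fun Y => g (A Y))).
  move=> sA; apply: three_form_wedge12 => [||Y Z|Y].
  - exact: gb.2.
  - split=> [Z h Y W|Y]; last exact: gb.2.
    by rewrite linearP !(formE gb).
  - by rewrite gS sA.
  - have := sA Y Y; rewrite gS => e; apply: CinfP => x.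
    have ex := congr1 (fun h : C => h x) e.
    by rewrite CinfE in ex; rewrite -[RHS]/(0 : R); lra.
have d3 : three_form (wedge12 (g (I X))
    (fun Y Z => g (J X) Y * g (K X) Z - g (J X) Z * g (K X) Y)).
  apply: three_form_wedge12 => [||Y Z|Y]; first exact: gb.2.
  - by split=> [Z h Y W|Y h Z W]; rewrite !(formE gb) /=; ring.
  - by ring.
  - by ring.
apply: (eq_three_form deform_torsion).
apply: three_formZ; apply: three_formD; last exact: three_formZ.
have wI := w3 I (I X) sI; have wJ := w3 J (J X) sJ; have wK := w3 K (K X) sK.
have bI := w3 BI (I X) BIs; have bJ := w3 BJ (J X) BJs; have bK := w3 BK (K X) BKs.
apply: three_formD.
  apply: three_formD; first exact: tors.
  exact: three_formZ (three_formD (three_formD bI bJ) bK).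
exact: three_formZ (three_formD (three_formD wI wJ) wK).
Qed.

End DeformConnection.

(** * Lie derivatives of the deformed metric *)

Section LieDerivative.
Variables (R : realType) (n : nat) (M : smoothManifold R n).
Local Notation C := (Cinf M).
Local Notation VF := (vectorField M).
Local Notation cstC a := (a *: (1 : C)).
Implicit Types (h F : C) (V W Y Z u v : VF).

Variables (I J K : {linear VF -> VF}) (g : VF -> VF -> C) (X : VF).
Hypotheses (q : quaternionic I J K) (gb : bilinear_form g).
Hypothesis gS : forall Y Z, g Y Z = g Z Y.
Hypotheses (hI : Defs.hermitian I g) (hJ : Defs.hermitian J g).
Hypothesis hK : Defs.hermitian K g.
Variables (a b : R) (f tv df dtv : C).
Local Notation g' := (deform I J K g X f tv).
Local Notation oX := (quaternionic_frame_orthogonal X q gb gS hI hJ hK).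

Lemma lie_metric_deform V (c : C) :
  (forall Y Z, lie_metric V g Y Z = c * g Y Z) -> forall Y Z,
  lie_metric V g' Y Z =
  (V f : C) * (g Y Z + tv * (g X Y * g X Z + g (I X) Y * g (I X) Z
                             + g (J X) Y * g (J X) Z + g (K X) Y * g (K X) Z))
  + f * (c * g Y Z
         + ((V tv : C) + c *+ 2 * tv) * (g X Y * g X Z + g (I X) Y * g (I X) Z
                             + g (J X) Y * g (J X) Z + g (K X) Y * g (K X) Z)
         + tv * (g (bracket V X) Y * g X Z + g X Y * g (bracket V X) Z
             + g (bracket V (I X)) Y * g (I X) Z + g (I X) Y * g (bracket V (I X)) Z
             + g (bracket V (J X)) Y * g (J X) Z + g (J X) Y * g (bracket V (J X)) Z
             + g (bracket V (K X)) Y * g (K X) Z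
             + g (K X) Y * g (bracket V (K X)) Z)).
Proof.
move=> LV Y Z.
have Vg Y1 Z1 : V (g Y1 Z1) =
    c * g Y1 Z1 + g (bracket V Y1) Z1 + g Y1 (bracket V Z1) :> C.
  by rewrite -LV /lie_metric; ring.
rewrite /lie_metric !(deformE I J K X gb) vfM vf_add vfM !vf_add !vfM !Vg.
ring.
Qed.

Hypothesis Xf : forall Y, Y f = df * g X Y.
Hypothesis Xtv : forall Y, Y tv = dtv * g X Y.
Variable k : R.
Hypothesis dfE : df * g X X = cstC ((k - 1) * a) * f.
Hypothesis dtvE : dtv * g X X = - cstC a * tv.
Hypothesis LX : forall Y Z, lie_metric X g Y Z = a *: g Y Z.
Hypothesis LQ : forall Y Z, [/\ lie_metric (I X) g Y Z = 0,
  lie_metric (J X) g Y Z = 0 & lie_metric (K X) g Y Z = 0].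
Hypotheses (XIX : bracket X (I X) = 0) (XJX : bracket X (J X) = 0).
Hypothesis XKX : bracket X (K X) = 0.
Hypothesis LE0 : forall Y, [/\ lie_endo (I X) I Y = 0, lie_endo (J X) J Y = 0 &
                    lie_endo (K X) K Y = 0].
Hypothesis LEb : forall Y, [/\ lie_endo (I X) J Y = cstC b *: K Y,
                    lie_endo (J X) K Y = cstC b *: I Y &
                    lie_endo (K X) I Y = cstC b *: J Y].

(** The fields [X], [IX], [JX], [KX] span a copy of the Lie algebra of the
    quaternions up to scale: [IX] commutes with [X] and rotates [JX] and [KX] into
    each other, which preserves the sum of squares that enters [g']. *)
Lemma deform_special_homothety : special_homothety (k * a) b I J K g' X.
Proof.
have IXX : bracket (I X) X = 0 by rewrite bracket_anti XIX oppr0.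
have JXX : bracket (J X) X = 0 by rewrite bracket_anti XJX oppr0.
have KXX : bracket (K X) X = 0 by rewrite bracket_anti XKX oppr0.
have IJX : bracket (I X) (J X) = cstC b *: K X.
  by have [<- _ _] := LEb X; rewrite /lie_endo IXX linear0 subr0.
have JKX : bracket (J X) (K X) = cstC b *: I X.
  by have [_ <- _] := LEb X; rewrite /lie_endo JXX linear0 subr0.
have KIX : bracket (K X) (I X) = cstC b *: J X.
  by have [_ _ <-] := LEb X; rewrite /lie_endo KXX linear0 subr0.
have JIX : bracket (J X) (I X) = - (cstC b *: K X) by rewrite bracket_anti IJX.
have KJX : bracket (K X) (J X) = - (cstC b *: I X) by rewrite bracket_anti JKX.
have IKX : bracket (I X) (K X) = - (cstC b *: J X) by rewrite bracket_anti KIX.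
have [[sI sJ] sK] := hermE q gb hI hJ hK.
have skew0 (A : {linear VF -> VF}) : g (A X) X = 0 ->
    (forall Y Z, g Y (A Z) = - g (A Y) Z) -> g X (A X) = 0.
  by move=> AX sA; rewrite sA AX oppr0.
split=> //.
- move=> Y Z; rewrite (lie_metric_deform (c := cstC a)) => [|{}Y {}Z]; last first.
    by rewrite LX; apply: CinfP => x; rewrite !CinfE; ring.
  rewrite Xf Xtv dfE dtvE (bracket_self X) XIX XJX XKX !(formE gb).
  have scaleE (c : R) h : c *: h = cstC c * h.
    by apply: CinfP => x; rewrite !CinfE mulr1.
  have -> : (k - 1) * a = k * a - a by ring.
  by rewrite (deformE I J K X gb) [RHS]scaleE scalerBl; ring.
- move=> Y Z; split.
  + rewrite (lie_metric_deform (c := 0)) => [|{}Y {}Z]; last first.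
      by have [-> _ _] := LQ Y Z; rewrite mul0r.
    rewrite Xf Xtv (skew0 I) ?oX // bracket_self IXX IJX IKX !(formE gb).
    by ring.
  + rewrite (lie_metric_deform (c := 0)) => [|{}Y {}Z]; last first.
      by have [_ -> _] := LQ Y Z; rewrite mul0r.
    rewrite Xf Xtv (skew0 J) ?oX // bracket_self JXX JIX JKX !(formE gb).
    by ring.
  + rewrite (lie_metric_deform (c := 0)) => [|{}Y {}Z]; last first.
      by have [_ _ ->] := LQ Y Z; rewrite mul0r.
    rewrite Xf Xtv (skew0 K) ?oX // bracket_self KXX KIX KJX !(formE gb).
    by ring.
Qed.

End LieDerivative.

(** * Changing the parameter of the symmetry *)

(** The hypothesis on the ratio covers both components of the admissible values:
    [alpha] and [alpha'] are both positive or both negative. For [alpha = -1] the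
    function [g(X, X)] would be constant along [X], and [k] would not exist. *)
Lemma D21_deformation (R : realType) (n : nat) (M : smoothManifold R n)
    (I J K : {linear vectorField M -> vectorField M})
    (g : vectorField M -> vectorField M -> Cinf M)
    (X : vectorField M) (alpha alpha' : R) :
  hypercomplex I J K -> HKT_metric I J K g -> definite g ->
  nowhere_zero X -> generates_D21 alpha I J K g X ->
  alpha <> -1 -> 0 < alpha' / alpha ->
  exists g' : vectorField M -> vectorField M -> Cinf M,
    [/\ HKT_metric I J K g', definite g' & has_D21_symmetry alpha' I J K g'].
Proof.
move=> [_ q] [[m1 [m2 [nE [gb gS sg]]]] hI hJ hK [nabla [cn ng [pI pJ pK] tors]]].
move=> dg X0 [a [b [[LX LQ LE0 LEb] b0' abE]]] alphaN1 ratio.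
have {}q : quaternionic I J K by [].
have alpha0 : alpha != 0.
  by apply: contraTneq ratio => ->; rewrite invr0 mulr0 ltxx.
have alpha1 : alpha + 1 != 0 by apply/eqP => e; apply: alphaN1; lra.
have b0 : b != 0 by apply/eqP.
have aE : a = b * (alpha + 1) by rewrite abE; field.
have a0 : a != 0 by rewrite aE mulf_neq0.
pose k := (alpha' + 1) / (alpha + 1).
pose t := (alpha' - alpha) / alpha.
have t1E : 1 + t = alpha' / alpha by rewrite /t; field.
have t1 : 0 < 1 + t by rewrite t1E.
have rt : t * (a - b) = (k - 1) * a.
  by rewrite /t /k aE; field; rewrite alpha0 alpha1.
have nX := nabla_homothety gb gS dg ng tors q hI hJ hK pI pJ pK LX LQ.
have frames x : exists e : 'I_(4 * m1 + 4 * m2) -> vectorField M, tangent_basis x e.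
  by have [e [be _]] := sg x; exists e.
have nu0 x : g X X x != 0.
  by case: dg => /(_ x X (X0 x)); rewrite lt_neqAle => /andP[]; rewrite // eq_sym.
have [f [iv [ivE f0 div df]]] := real_power (k - 1) nu0.
have dnu := derive_sqnorm gb gS ng nX.
have lin A : linear (centralizing_torsion nabla a b X A).
  exact: centralizing_torsion_linear gb gS dg tors a b X A.
pose B (A : {linear vectorField M -> vectorField M}) :
    {linear vectorField M -> vectorField M} :=
  HB.pack (centralizing_torsion nabla a b X A)
    (GRing.isLinear.Build _ _ _ _ _ (lin A)).
have [[sI sJ] sK] := hermE q gb hI hJ hK.
have qJ := quaternionic_cyc q; have qK := quaternionic_cyc qJ.
have LII Y : lie_endo (I X) I Y = 0 by case: (LE0 Y).
have LJJ Y : lie_endo (J X) J Y = 0 by case: (LE0 Y).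
have LKK Y : lie_endo (K X) K Y = 0 by case: (LE0 Y).
have LIJ Y : lie_endo (I X) J Y = (b *: (1 : Cinf M)) *: K Y by case: (LEb Y).
have LJK Y : lie_endo (J X) K Y = (b *: (1 : Cinf M)) *: I Y by case: (LEb Y).
have LKI Y : lie_endo (K X) I Y = (b *: (1 : Cinf M)) *: J Y by case: (LEb Y).
have BI Y : [/\ B I (I Y) = I (B I Y), B I (J Y) = J (B I Y) &
                B I (K Y) = K (B I Y)].
  exact: (centralizing_torsionP nX q pI pJ LII LIJ).
have BJ Y : [/\ B J (I Y) = I (B J Y), B J (J Y) = J (B J Y) &
                B J (K Y) = K (B J Y)].
  by have [? ? ?] := centralizing_torsionP nX qJ pJ pK LJJ LJK Y.
have BK Y : [/\ B K (I Y) = I (B K Y), B K (J Y) = J (B K Y) &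
                B K (K Y) = K (B K Y)].
  by have [? ? ?] := centralizing_torsionP nX qK pK pI LKK LKI Y.
have Bs (A : {linear vectorField M -> vectorField M}) :
    (forall Y Z, g Y (A Z) = - g (A Y) Z) ->
    forall Y Z, g Y (B A Z) = - g (B A Y) Z.
  move=> sA Y Z; rewrite [g (B A Y) Z]gS.
  by rewrite -(centralizing_torsion_skew gb gS tors a b X sA Z Y).
have TX Y Z : g X (torsion nabla Y Z) = 0.
  rewrite (torsion_cyc gb tors) (torsion_homothety gb gS dg ng tors nX Y a0).
  by rewrite (formE gb).
have TB A := torsion_centralizing gb gS tors a b X A.
pose cstC (c : R) : Cinf M := c *: (1 : Cinf M).
(* With these coefficients the identities required of the correction reduce to
   [t (a - b) = (k - 1) a]. *)
pose tv := cstC t * iv; pose w := cstC (t / (1 + t)) * iv.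
pose p := cstC ((k - 1) * a / 2) * iv.
pose r := cstC (t * a / 2 - (k - 1) * a / 2) * iv.
pose s := cstC (t * a * (k - 2) / 2) * (iv * iv).
have t10 : 1 + t != 0 by rewrite gt_eqF.
have wE : w + w * tv * g X X = tv.
  apply: CinfP => x; rewrite !CinfE ivE; move: (nu0 x) => nux.
  by field; rewrite nux t10.
have dfp (Y : vectorField M) : Y f = p *+ 2 * f * g X Y.
  by rewrite df dnu; apply: CinfP => x; rewrite mulr2n !CinfE; field.
have dtv (Y : vectorField M) : Y tv = (s *+ 2 - p *+ 2 * tv) * g X Y.
  rewrite vfM vf_scale vf1 div dnu.
  by apply: CinfP => x; rewrite !mulr2n !CinfE; field.
have rpE : r + p = cstC (a / 2) * tv.
  by apply: CinfP => x; rewrite !CinfE; field.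
have rE : r *+ 2 = cstC ((a + b) / 2) * tv - p.
  apply: CinfP => x; rewrite mulr2n !CinfE.
  have -> : t * a / 2 - (k - 1) * a / 2 = (t * (a + b) / 2 - (k - 1) * a / 2) / 2.
    by rewrite -rt; field.
  by field.
have gb' : bilinear_form (deform I J K g X f tv) :=
  deform_bilinear I J K X gb f tv.
have sg' : has_signature (4 * m1) (4 * m2) (deform I J K g X f tv).
  by have := deform_signature q gb gS hI hJ hK nu0 ivE f0 frames t1 erefl sg.
exists (deform I J K g X f tv); split.
- split.
  + exists m1, m2; split; first exact: nE.
    by split; [exact: gb'|exact: (deform_sym I J K X gb gS)|exact: sg'].
  + exact: (deform_hermitianI X q gb hI hJ hK).
  + exact: (deform_hermitianJ X q gb hI hJ hK).
  + exact: (deform_hermitianK X q gb hI hJ hK).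
  exists (deform_nabla I J K g X nabla (B I) (B J) (B K) tv w p r s); split.
  + exact: deform_connection.
  + exact: (deform_parallel q gb gS hI hJ hK ng pI pJ pK
      (Bs I sI) (Bs J sJ) (Bs K sK) nX wE dfp dtv rpE).
  + split.
    * exact: deform_parallelI.
    * exact: deform_parallelJ.
    * exact: deform_parallelK.
  exact: (deform_torsion_three_form q gb gS hI hJ hK tors
    (Bs I sI) (Bs J sJ) (Bs K sK) TX (TB I) (TB J) (TB K) f s wE rE).
- have sgn eps := deform_definite_signed q gb gS hI hJ hK nu0 ivE f0 frames t1
    (eps := eps).
  case: dg => [pg|ng']; [left|right] => x Y Yx.
    by rewrite -[ltRHS]mul1r; apply: sgn Yx => y Z Zy; rewrite mul1r; exact: pg.
  rewrite -oppr_gt0 -mulN1r; apply: sgn Yx => y Z Zy.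
  by rewrite mulN1r oppr_gt0; exact: ng'.
have nXX (A : {linear vectorField M -> vectorField M}) :
    parallel_endo nabla A -> bracket X (A X) = 0.
  move=> pA; rewrite (bracket_torsion nabla) pA !nX (linearZ_LR A).
  by rewrite (torsion_homothety gb gS dg ng tors nX _ a0) subrr subr0.
exists X, (k * a), b; split; [|exact: b0'|]; last first.
  by rewrite /k aE; field; rewrite b0 alpha1.
apply: (deform_special_homothety q gb gS hI hJ hK (df := p *+ 2 * f)
  (dtv := s *+ 2 - p *+ 2 * tv) dfp dtv _ _ LX LQ _ _ _ LE0 LEb).
- by apply: CinfP => x; rewrite mulr2n !CinfE ivE; move: (nu0 x) => nux; field.
- apply: CinfP => x; rewrite !mulr2n !CinfE ivE; move: (nu0 x) => nux.
  by field.
- exact: nXX.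
- exact: nXX.
- exact: nXX.
Qed.

Theorem corollary3p2 (R : realType) (m : nat) (M : smoothManifold R (4 * m)%N)
    (I J K : {linear vectorField M -> vectorField M})
    (g : vectorField M -> vectorField M -> Cinf M)
    (X : vectorField M) (alpha : R) :
  hypercomplex I J K -> HKT_metric I J K g -> definite g ->
  nowhere_zero X -> generates_D21 alpha I J K g X ->
  (0 < alpha -> forall alpha' : R, 0 < alpha' ->
     exists g' : vectorField M -> vectorField M -> Cinf M,
       [/\ HKT_metric I J K g', definite g' & has_D21_symmetry alpha' I J K g']) /\
  (alpha < 0 -> alpha <> -1 -> forall alpha' : R, alpha' < 0 ->
     exists g' : vectorField M -> vectorField M -> Cinf M,
       [/\ HKT_metric I J K g', definite g' & has_D21_symmetry alpha' I J K g']).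
Proof.
move=> hc hkt dg X0 gen; split=> [alpha0 alpha' alpha'0|alpha0 alphaN1 alpha' alpha'0].
  apply: (D21_deformation hc hkt dg X0 gen); last exact: divr_gt0.
  by move=> e; lra.
apply: (D21_deformation hc hkt dg X0 gen) => //.
by rewrite -mulrNN -invrN divr_gt0 // oppr_gt0.
Qed.
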